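(* Let $\Sigma$ be a simplicial complex on ground set $[n]=\{1,\dots,n\}$. Let $d$ and $\ell$ be integers with $0\le\ell\le d$, and put $m = d-n+\chi(\mathrm{KG}(\Sigma))+2$. Suppose $0\le m\le\ell$. If the integers $m$ and $\ell-m$ do not share common ones in their binary expansions, then $\mathrm{AEmb}_\ell(\Sigma,\mathbb{R}^d)$, and thus $\mathrm{Emb}_\ell(\Sigma,\mathbb{R}^d)$, has coindex at most $m-1$.
   Context: Simplicial complexes are abstract simplicial complexes (containing the empty face), and we write $\Sigma$ also for the geometric realization. $\mathrm{KG}(\Sigma)$ is the Kneser graph of the nonfaces of $\Sigma$: its vertices are the subsets of $[n]$ that are not faces of $\Sigma$, with an edge between two of them if they are disjoint. $\chi(G)$ is the chromatic number of a graph $G$ (the least number of colors in a proper vertex coloring; it is $0$ for the graph without vertices). A continuous map $f\colon\Sigma\to\mathbb{R}^d$ is an almost-embedding if $f(\sigma)\cap f(\tau)=\emptyset$ for any two vertex-disjoint faces $\sigma,\tau$ of $\Sigma$. $\mathrm{AEmb}(\Sigma,\mathbb{R}^d)$ and $\mathrm{Emb}(\Sigma,\mathbb{R}^d)$ are the spaces of almost-embeddings and of embeddings $\Sigma\to\mathbb{R}^d$, respectively, with the compact-open topology. $\mathrm{AEmb}_\ell(\Sigma,\mathbb{R}^d)$ and $\mathrm{Emb}_\ell(\Sigma,\mathbb{R}^d)$ are these spaces with the $\mathbb{Z}/2$-action whose generator $\varepsilon$ acts by $(\varepsilon\cdot f)(x)=\varepsilon\cdot f(x)$, where $\varepsilon\cdot(x_1,\dots,x_d)=(-x_1,\dots,-x_\ell,x_{\ell+1},\dots,x_d)$.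 The coindex of a $\mathbb{Z}/2$-space $Y$ is the largest integer $k$ such that there is a continuous $\mathbb{Z}/2$-equivariant map $S^k\to Y$, where $S^k$ carries the antipodal action; by convention $S^{-1}=\emptyset$, so the empty space has coindex $-1$. Two nonnegative integers share a common one in their binary expansions if there is a position in which both have binary digit 1. *)

(* Defs.v *)
From HB Require Import structures.
From mathcomp Require Import all_boot all_order all_algebra.
From mathcomp Require Import all_classical all_reals all_analysis.
Set Implicit Arguments.
Unset Strict Implicit.
Unset Printing Implicit Defensive.
Import Order.TTheory GRing.Theory Num.Theory.
Import numFieldNormedType.Exports.
Local Open Scope classical_set_scope.
Local Open Scope ring_scope.

(* A point of the ground set need not be a vertex: [set i] may be a nonface. *)
Record simplicial_complex (n : nat) := SimplicialComplex {
  faces :> {set {set 'I_n}} ;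
  face0 : finset.set0 \in faces ;
  face_sub : forall s t : {set 'I_n}, t \subset s -> s \in faces -> t \in faces
}.

Record sgraph := SGraph {
  vertex :> finType ;
  adj : rel vertex ;
  adj_sym : symmetric adj ;
  adj_irr : irreflexive adj
}.

Definition colorable (G : sgraph) (k : nat) : bool :=
  [exists c : {ffun G -> 'I_k}, forall x, forall y, adj x y ==> (c x != c y)].

Lemma ex_colorable (G : sgraph) : exists k, colorable G k.
Proof.
exists #|G|; apply/existsP; exists [ffun x => enum_rank x].
apply/forallP => x; apply/forallP => y; apply/implyP => xy.
rewrite !ffunE; apply: contraTneq xy => /enum_rank_inj ->.
by rewrite adj_irr.
Qed.

Definition chromatic_number (G : sgraph) : nat := ex_minn (ex_colorable G).

Section Kneser.
Context (n : nat) (Sigma : simplicial_complex n).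

Definition nonface := {s : {set 'I_n} | s \notin faces Sigma}.

Definition kneser_adj : rel nonface := fun s t => [disjoint val s & val t]%B.

Lemma kneser_adj_sym : symmetric kneser_adj.
Proof. by move=> s t; rewrite /kneser_adj disjoint_sym. Qed.

Lemma kneser_adj_irr : irreflexive kneser_adj.
Proof.
move=> s; apply/negP; rewrite /kneser_adj -setI_eq0 finset.setIid => /eqP s0.
by have := valP s; rewrite s0 face0.
Qed.

Definition KG : sgraph := SGraph kneser_adj_sym kneser_adj_irr.

End Kneser.

Record Z2space := MkZ2Space {
  Z2sort :> topologicalType ;
  Z2act : Z2sort -> Z2sort ;
  Z2act_continuous : continuous Z2act ;
  Z2actK : involutive Z2act
}.

(* The Z/2-space obtained from an invariant subset, with the subspace
   topology and the restricted involution. *)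
Section Z2sub.
Context (X : topologicalType) (a : X -> X) (A : set X).
Hypothesis a_continuous : continuous a.
Hypothesis aK : involutive a.
Hypothesis A_stable : forall x, A x -> A (a x).

Lemma Z2sub_in (x : A) : a (val x) \in A.
Proof. by rewrite inE; apply/A_stable/set_valP. Qed.

Definition Z2sub_act (x : A) : A := exist _ (a (val x)) (Z2sub_in x).

Lemma Z2sub_act_continuous : continuous Z2sub_act.
Proof.
apply: continuous_comp_initial => x.
apply: (@continuous_comp _ _ _ (set_val : A -> X) a); last exact: a_continuous.
exact: initial_continuous.
Qed.

Lemma Z2sub_actK : involutive Z2sub_act.
Proof. by move=> x; apply: val_inj; rewrite /= aK. Qed.

Definition Z2sub : Z2space := MkZ2Space Z2sub_act_continuous Z2sub_actK.

End Z2sub.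

Section Coindex.
Context (R : realType).

(* The unit sphere of R^k, that is, S^(k-1); it is empty for k = 0. *)
Definition sphere_set (k : nat) : set 'rV[R]_k :=
  [set x | \sum_i x 0 i ^+ 2 = 1].

Lemma sphere_setN k (x : 'rV[R]_k) : sphere_set x -> sphere_set (- x).
Proof.
by rewrite /sphere_set /= => <-; apply: eq_bigr => i _; rewrite mxE sqrrN.
Qed.

Definition sphere (k : nat) : Z2space :=
  Z2sub (@opp_continuous 'rV[R]_k) (@opprK 'rV[R]_k) (@sphere_setN k).

Definition equivariant (X Y : Z2space) (f : X -> Y) :=
  forall x, f (Z2act x) = Z2act (f x).

(* The supremum is a maximum when finite, and +oo when spheres of arbitrarily
   large dimension map to Y. *)
Definition coindex (Y : Z2space) : \bar R :=
  ereal_sup [set (k%:R - 1)%:E | k in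
    [set k | exists f : sphere k -> Y, continuous f /\ equivariant f]].

End Coindex.

Section AlmostEmbeddings.
Context (R : realType) (n : nat) (Sigma : simplicial_complex n).

Definition vsupport (x : 'rV[R]_n) : {set 'I_n} := [set i | x 0 i != 0]%SET.

Definition realization_set : set 'rV[R]_n :=
  [set x : 'rV[R]_n | [/\ forall i, 0 <= x 0 i, \sum_i x 0 i = 1
             & vsupport x \in faces Sigma]].

Definition realization : topologicalType := set_type realization_set.

Definition closed_face (s : {set 'I_n}) : set realization :=
  [set x | vsupport (val x) \subset s].

Context (d : nat).

Definition map_space : topologicalType := {compact-open, realization -> 'rV[R]_d}.

Definition AEmb_set : set map_space :=
  [set f | continuous (f : realization -> 'rV[R]_d) /\
    forall s t, s \in faces Sigma -> t \in faces Sigma -> [disjoint s & t]%B ->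
      f @` closed_face s `&` f @` closed_face t = set0].

(* The last clause says that the inverse bijection from the image of f (with
   the subspace topology) to the realization is continuous. *)
Definition Emb_set : set map_space :=
  [set f | [/\ continuous (f : realization -> 'rV[R]_d),
    injective (f : realization -> 'rV[R]_d) &
    forall U : set realization, open U ->
      exists2 V : set 'rV[R]_d, open V & U = f @^-1` V]].

Context (l : nat).

Definition reflect_coords (y : 'rV[R]_d) : 'rV[R]_d :=
  \row_(i < d) (if (i < l)%N then - y 0 i else y 0 i).

Definition reflect_map (f : map_space) : map_space := reflect_coords \o f.

Lemma reflect_coordsK : involutive reflect_coords.
Proof.
by move=> y; apply/rowP => i; rewrite !mxE; case: (i < l)%N; rewrite ?opprK.
Qed.

Lemma reflect_coords_continuous : continuous reflect_coords.
Proof.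
move=> y A [P Py PA].
exists (fun i j => [set z : R | P i j (if (j < l)%N then - z else z)]).
  move=> i j; have := Py i j; rewrite (ord1 i) mxE; case: ifP => _ //.
  exact: opp_continuous.
move=> z Pz; apply: PA => i j; have := Pz i j.
by rewrite (ord1 i) mxE /=; case: ifP.
Qed.

Lemma reflect_mapK : involutive reflect_map.
Proof. by move=> f; apply/funext => x; exact: reflect_coordsK. Qed.

Lemma reflect_map_continuous : continuous reflect_map.
Proof.
move=> f; have ff : Filter (nbhs (f : map_space)) by exact: nbhs_filter.
apply: (iffRL (compact_open_cvgP _ (fmap_filter reflect_map ff))).
move=> K O cK oO fKO.
have oO' : open (reflect_coords @^-1` O).
  by apply: open_comp => // y _; exact: reflect_coords_continuous.
have := compact_open_open cK oO'; rewrite openE => /(_ f).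
rewrite /interior => /(_ _)/filterS; apply => [g gK _ [x Kx <-]|_ [x Kx <-]].
  by apply: gK; exists x.
by apply: fKO; exists x.
Qed.

Lemma reflect_coords_comp_continuous (f : realization -> 'rV[R]_d) :
  continuous f -> continuous (reflect_coords \o f).
Proof.
move=> cf x; apply: continuous_comp; first exact: cf.
exact: reflect_coords_continuous.
Qed.

Lemma AEmb_stable f : AEmb_set f -> AEmb_set (reflect_map f).
Proof.
case=> cf fd; split; first exact: reflect_coords_comp_continuous.
move=> s t sS tS st; rewrite -subset0 => _ [[x xs <-] [y yt]].
move=> /(can_inj reflect_coordsK) yx.
suff : (f @` closed_face s `&` f @` closed_face t) (f x) by rewrite fd.
by split; [exists x | exists y].
Qed.

Lemma Emb_stable f : Emb_set f -> Emb_set (reflect_map f).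
Proof.
case=> cf fI fo; split; first exact: reflect_coords_comp_continuous.
  by move=> x y /(can_inj reflect_coordsK)/fI.
move=> U /fo[V oV ->]; exists (reflect_coords @^-1` V).
  by apply: open_comp => // y _; exact: reflect_coords_continuous.
by apply/funext => x; rewrite /preimage /mkset /reflect_map /= reflect_coordsK.
Qed.

Definition AEmb : Z2space := Z2sub reflect_map_continuous reflect_mapK AEmb_stable.

Definition Emb : Z2space := Z2sub reflect_map_continuous reflect_mapK Emb_stable.

End AlmostEmbeddings.

Definition binary_digit (i a : nat) : bool := odd (a %/ 2 ^ i).

Definition share_common_one (a b : nat) : Prop :=
  exists i, binary_digit i a /\ binary_digit i b.

(* Main.v *)
Require Import Defs.
From HB Require Import structures.
From mathcomp Require Import all_boot all_order all_algebra.
From mathcomp Require Import all_classical all_reals all_analysis.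
From mathcomp Require Import ring lra zify.
Set Implicit Arguments.
Unset Strict Implicit.
Unset Printing Implicit Defensive.
Import Order.TTheory GRing.Theory Num.Theory.
Import numFieldNormedType.Exports.
Local Open Scope classical_set_scope.
Local Open Scope ring_scope.

(** Let [f] be an equivariant map from [S^(k-1)], [k > m], to the space of
    almost-embeddings.  It yields a nowhere vanishing map
    [Phi : (R^k \ 0) * (R^n \ 0) -> R^N], [N = m + n - 1], as follows.  Write
    [x = u - v] with [u, v >= 0] of disjoint supports.  For a proper colouring of
    the Kneser graph, the colour [j] contributes the coordinate [M_j u - M_j v],
    where [M_j u] is the sum of the products [\prod_(i in s) u_i] over the nonfaces
    [s] of colour [j].  Since nonfaces of the same colour intersect, these all
    vanish only if the supports of [u] and [v] are faces.  There, the [d + 1]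
    remaining coordinates are [|u| - |v|] and
    [|u| f(y)(u/|u|) - |v| f(y)(v/|v|)], which have no common zero because [f(y)]
    is an almost-embedding.  Replacing [y] by [-y] changes the sign of the first
    [l] coordinates, replacing [x] by [-x] that of all.

    Such a map exists only if the coefficient ['C(l, m)] of [a^m b^(n-1)] in
    [(a + b)^l b^(N-l)] is even.  Indeed, let [s_i] be the sign of [Phi_i], a
    mod 2 cochain on finite sequences of points, and let [c_(p,q)] be chains with
    [d c_(p,q) = (1 + g) c_(p-1,q) + (1 + h) c_(p,q-1)], where [g] and [h] are the
    antipodes of the two factors.  By the Leibniz rule and Pascal's rule, the cup
    product of the coboundaries of the [s_i] takes the value ['C(l, m)] on
    [c_(m,n-1)].  This also holds for a subdivision so fine that on each simplex
    some [Phi_i] has no zero; then [s_i] is constant there and the value is 0. *)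

(** * Mod 2 cochains on finite sequences of points *)

Lemma addrr_bool (a : bool) : a + a = 0. Proof. by case: a. Qed.

Section Cochains.
Context (V : eqType).
Implicit Types (phi psi : seq V -> bool) (g : V -> V) (v : V) (s t : seq V).

Definition prefix_by v phi : seq V -> bool := fun s => phi (v :: s).

(* The complex is augmented: [phi [::]] is the value on the empty simplex. *)
Fixpoint cobd phi s : bool :=
  if s is v :: t then phi t + cobd (prefix_by v phi) t else 0.

Definition pull g phi : seq V -> bool := fun s => phi (map g s).

Lemma cobd_ext phi psi s :
  (forall t, size s = (size t).+1 -> {subset t <= s} -> phi t = psi t) ->
  cobd phi s = cobd psi s.
Proof.
elim: s phi psi => //= v s IHs phi psi eq_phi; congr (_ + _).
  by apply: eq_phi => // u us; rewrite inE us orbT.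
apply: IHs => t st ts; apply: eq_phi; first by rewrite /= st.
by move=> u; rewrite !inE => /orP[->//|/ts ->]; rewrite orbT.
Qed.

Lemma cobd0 s : cobd (fun=> 0) s = 0.
Proof. by elim: s => //= v s; rewrite /prefix_by => ->. Qed.

Lemma cobdD phi psi s : cobd (phi \+ psi) s = cobd phi s + cobd psi s.
Proof.
elim: s phi psi => [|v s IHs] phi psi /=; first by rewrite addr0.
by rewrite addrACA -IHs.
Qed.

Lemma cobd_cobd phi s : cobd (cobd phi) s = 0.
Proof.
elim: s phi => //= v s IHs phi.
rewrite -[prefix_by v _]/(phi \+ cobd (prefix_by v phi)) cobdD IHs addr0.
exact: addrr_bool.
Qed.

Lemma cobd_pull g phi : cobd (pull g phi) = pull g (cobd phi).
Proof.
apply/funext => s; rewrite /pull; elim: s phi => //= v s IHs phi.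
by congr (_ + _); rewrite -IHs.
Qed.

(** The cup product, by the front-face formula, of the coboundaries of the 0-cochains in [fs]; it
    vanishes on sequences of length other than [size fs + 1]. *)
Fixpoint cup (fs : seq (V -> bool)) s : bool :=
  match fs, s with
  | [::], [:: _] => 1
  | f :: fs', v0 :: (v1 :: _) as t => (f v0 + f v1) * cup fs' t
  | _, _ => 0
  end.

Definition cup_primitive (f : V -> bool) (fs : seq (V -> bool)) s : bool :=
  if s is v :: _ then f v * cup fs s else 0.

Lemma cobd_scale (a : bool) phi s : cobd (fun t => a * phi t) s = a * cobd phi s.
Proof.
elim: s phi => [|v s IHs] phi /=; first by rewrite mulr0.
by rewrite mulrDr -IHs.
Qed.

(** The Leibniz rule for the 0-cochain [f] times [cup fs]: the term with the coboundary of [cup fs]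
    is zero by assumption. *)
Lemma cobd_cup_primitive f fs s :
  cobd (cup fs) s = 0 -> cobd (cup_primitive f fs) s = cup (f :: fs) s.
Proof.
case: s => [|v [|w s]] //= cup0.
have -> : prefix_by w (prefix_by v (cup_primitive f fs)) =
    fun t => f v * prefix_by w (prefix_by v (cup fs)) t by [].
rewrite cobd_scale -mulrDr mulrDl [RHS]addrC; congr (_ + f v * _).
rewrite /prefix_by in cup0 *; move: cup0.
by case: (cup fs (w :: s)); case: (cup fs (v :: s)); case: (cobd _ _).
Qed.

(** A nonempty product is a coboundary by the Leibniz rule, and the empty one is the unit
    cocycle. *)
Lemma cobd_cup fs s : cobd (cup fs) s = 0.
Proof.
elim: fs s => [|f fs IHfs] s; last first.
  rewrite -(cobd_cobd (cup_primitive f fs) s); congr cobd.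
  by apply/funext => t; rewrite cobd_cup_primitive.
case: s => [|v [|w s]] //=; rewrite /prefix_by /=.
case: s => [|x s] //=; rewrite /prefix_by /= !add0r.
exact: cobd0.
Qed.

End Cochains.

(** * Barycentric subdivision acting on cochains *)

Section Subdivision.
Context (V : eqType) (bary : seq V -> V).
Implicit Types (phi psi : seq V -> bool) (g : V -> V) (v : V) (s t : seq V).

(** The recursion goes through faces of [s], which need not be tails, so it runs on [n], taken to be
    the size of [s]. *)
Fixpoint sd_rec n phi s : bool :=
  match n, s with
  | n'.+1, _ :: _ => cobd (sd_rec n' (prefix_by (bary s) phi)) s
  | _, _ => phi s
  end.

(* The transpose of barycentric subdivision, the cone from [bary s] over the
   subdivided boundary of [s]. *)
Definition sd phi s := sd_rec (size s) phi s.

Lemma sd_nil phi : sd phi [::] = phi [::]. Proof. by []. Qed.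

Lemma sdE phi s : s != [::] -> sd phi s = cobd (sd (prefix_by (bary s) phi)) s.
Proof.
case: s => // v s _; rewrite /sd [LHS]/=; rewrite -/(cobd _ (v :: s)).
by apply: cobd_ext => t [->].
Qed.

(** [C] stands for a convex set. Subdivision keeps the dimension of a simplex and stays in every
    convex set containing its vertices, so only such simplices matter. *)
Lemma sd_ext (C : V -> Prop) phi psi s :
    (forall t, t != [::] -> (forall v, v \in t -> C v) -> C (bary t)) ->
    (forall v, v \in s -> C v) ->
    (forall t, size t = size s -> (forall v, v \in t -> C v) -> phi t = psi t) ->
  sd phi s = sd psi s.
Proof.
move=> barC; move: {2}(size s) (erefl (size s)) => n.
elim: n s phi psi => [|n IHn] s phi psi sn Cs eq_phi.
  by move/size0nil: sn eq_phi => -> eq_phi; rewrite !sd_nil eq_phi.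
have s0 : s != [::] by rewrite -size_eq0 sn.
rewrite !sdE //; apply: cobd_ext => t st ts.
apply: IHn; first by apply: succn_inj; rewrite -st.
  by move=> v /ts/Cs.
move=> u ut Cu; apply: eq_phi; first by rewrite /= st ut.
by move=> v /[!inE] /orP[/eqP-> | /Cu //]; apply: barC.
Qed.

Lemma sdD phi psi : sd (phi \+ psi) = sd phi \+ sd psi.
Proof.
apply/funext => s /=; move: {2}(size s) (erefl (size s)) => n.
elim: n s phi psi => [|n IHn] s phi psi sn; first by move/size0nil: sn => ->.
have s0 : s != [::] by rewrite -size_eq0 sn.
rewrite !sdE // -cobdD; apply: cobd_ext => t st _.
by rewrite /= -IHn //; apply: succn_inj; rewrite -st.
Qed.

Lemma sd_pull g phi : (forall s, bary (map g s) = g (bary s)) ->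
  sd (pull g phi) = pull g (sd phi).
Proof.
move=> barg; apply/funext => s; rewrite /pull.
move: {2}(size s) (erefl (size s)) => n.
elim: n s phi => [|n IHn] s phi sn; first by move/size0nil: sn => ->.
have s0 : s != [::] by rewrite -size_eq0 sn.
have gs0 : map g s != [::] by rewrite -size_eq0 size_map sn.
rewrite !sdE // barg -/(pull g (cobd _) s) -cobd_pull.
apply: cobd_ext => t st _; rewrite /pull -IHn //.
by apply: succn_inj; rewrite -st.
Qed.

(** The boundary of a cone is its base plus the cone over the boundary of the base. The base here is
    a cycle, so the second term vanishes. *)
Lemma sd_cobd phi : sd (cobd phi) = cobd (sd phi).
Proof.
apply/funext => s; move: {2}(size s) (erefl (size s)) => n.
elim: n s phi => [|n IHn] s phi sn; first by move/size0nil: sn => ->.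
have s0 : s != [::] by rewrite -size_eq0 sn.
rewrite sdE //; set b := bary s.
rewrite -[prefix_by b _]/(phi \+ cobd (prefix_by b phi)) sdD cobdD.
rewrite -[RHS]addr0; congr (_ + _); rewrite -(cobd_cobd (sd (prefix_by b phi)) s).
apply: cobd_ext => t st _; apply: IHn.
by apply: succn_inj; rewrite -st.
Qed.

End Subdivision.

(** * The chains [c_(p,q)] and their boundaries *)

Section Staircase.
Context (V : eqType) (g1 g2 : V -> V) (b : nat -> nat -> V).
Hypotheses (g1K : involutive g1) (g2K : involutive g2).
Hypothesis g12 : forall v, g1 (g2 v) = g2 (g1 v).
Implicit Types (phi psi : seq V -> bool) (v : V) (s t : seq V) (p q : nat).

(* Evaluation on the chain [c_(p,q)], the cone from [b p q] over
   [(1 + g1) c_(p-1,q) + (1 + g2) c_(p,q-1)]. *)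
Fixpoint cell p := fix cell_p q phi : bool :=
  let psi := prefix_by (b p q) phi in
  (if p is p'.+1 then cell p' q (psi \+ pull g1 psi)
   else if q is 0 then psi [::] else 0)
  + (if q is q'.+1 then cell_p q' (psi \+ pull g2 psi) else 0).

(** Evaluation on the base of the cone, which will be the boundary of [c_(p,q)]; for [p = q = 0] the
    base is the empty simplex of the augmented complex. *)
Definition cell_bd p q phi : bool :=
  (if p is p'.+1 then cell p' q (phi \+ pull g1 phi)
   else if q is 0 then phi [::] else 0)
  + (if q is q'.+1 then cell p q' (phi \+ pull g2 phi) else 0).

Arguments cell : simpl never.

Lemma cellE p q phi : cell p q phi = cell_bd p q (prefix_by (b p q) phi).
Proof. by case: p; case: q. Qed.

(* The simplices of [c_(p,q)]. *)
Inductive staircase : nat -> nat -> seq V -> Prop :=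
| staircase0 : staircase 0 0 [:: b 0 0]
| staircase_l p q s : staircase p q s -> staircase p.+1 q (b p.+1 q :: s)
| staircase_lg p q s : staircase p q s -> staircase p.+1 q (b p.+1 q :: map g1 s)
| staircase_r p q s : staircase p q s -> staircase p q.+1 (b p q.+1 :: s)
| staircase_rg p q s : staircase p q s -> staircase p q.+1 (b p q.+1 :: map g2 s).

Lemma size_staircase p q s : staircase p q s -> size s = (p + q).+1.
Proof. by elim=> //= {}p {}q {}s _; rewrite ?size_map => ->; rewrite ?addnS. Qed.

Lemma cell_ext p q phi psi :
  (forall s, staircase p q s -> phi s = psi s) -> cell p q phi = cell p q psi.
Proof.
move: {2}(p + q)%N (erefl (p + q)%N) => n.
elim: n p q phi psi => [|n IHn] p q phi psi pqn eq_phi.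
  case: p q pqn eq_phi => [|//] [|//] _ eq_phi; rewrite !cellE /cell_bd.
  rewrite !addr0 /prefix_by.
  by apply: eq_phi; constructor.
rewrite !cellE; congr (_ + _).
  case: p pqn eq_phi => [|p] pqn eq_phi; first by case: q pqn {eq_phi}.
  apply: IHn => [|s sts]; first by apply: succn_inj; rewrite -pqn.
  by rewrite /= /pull /prefix_by !eq_phi //; constructor.
case: q pqn eq_phi => [//|q] pqn eq_phi.
apply: IHn => [|s sts]; first by apply: succn_inj; rewrite -pqn addnS.
by rewrite /= /pull /prefix_by !eq_phi //; constructor.
Qed.

Lemma cell0 p q : cell p q (fun=> 0) = 0.
Proof.
move: {2}(p + q)%N (erefl (p + q)%N) => n.
elim: n p q => [|n IHn] p q; first by case: p q => [|//] [|//].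
have E g : (fun=> 0) \+ pull g (fun=> 0) = (fun=> 0) :> (seq V -> bool).
  by apply/funext => s; rewrite /= /pull addr0.
move=> pqn; rewrite cellE -[prefix_by _ _]/(fun=> 0 : bool) /cell_bd.
case: p q pqn => [|p] [|q] // pqn; rewrite ?E ?IHn //; apply: succn_inj;
  by rewrite -pqn ?addnS ?addn0.
Qed.

Lemma cellD p q phi psi :
  cell p q (phi \+ psi) = cell p q phi + cell p q psi.
Proof.
move: {2}(p + q)%N (erefl (p + q)%N) => n.
elim: n p q phi psi => [|n IHn] p q phi psi pqn.
  by case: p q pqn => [|//] [|//] _; rewrite !cellE /cell_bd /= !addr0.
rewrite !cellE /cell_bd [RHS]addrACA; congr (_ + _).
  case: p pqn => [|p] pqn; first by case: q pqn.
  rewrite -IHn; last by apply: succn_inj; rewrite -pqn.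
  by apply: cell_ext => s _ /=; rewrite [RHS]addrACA.
case: q pqn => [|q] pqn; first by rewrite addr0.
rewrite -IHn; last by apply: succn_inj; rewrite -pqn addnS.
by apply: cell_ext => s _ /=; rewrite [RHS]addrACA.
Qed.

Lemma cell_bdD p q phi psi :
  cell_bd p q (phi \+ psi) = cell_bd p q phi + cell_bd p q psi.
Proof.
rewrite /cell_bd [RHS]addrACA; congr (_ + _).
  case: p => [|p]; first by case: q.
  by rewrite -cellD; apply: cell_ext => s _ /=; rewrite [RHS]addrACA.
case: q => [|q]; first by rewrite addr0.
by rewrite -cellD; apply: cell_ext => s _ /=; rewrite [RHS]addrACA.
Qed.

(** The boundary of a cone is its base if the base is a cycle. Here it is one, because
    [(1 + g)^2 = 0] mod 2 for an involution [g], and the mixed terms cancel since [g1] and [g2]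
    commute. *)
Lemma cell_cobd p q phi : cell p q (cobd phi) = cell_bd p q phi.
Proof.
move: {2}(p + q)%N (erefl (p + q)%N) => n.
elim: n p q phi => [|n IHn] p q phi pqn.
  by case: p q pqn => [|//] [|//] _; rewrite cellE /cell_bd /prefix_by /= !addr0.
have sq0 (g : V -> V) f : involutive g ->
    (f \+ pull g f) \+ pull g (f \+ pull g f) = fun=> 0.
  move=> gK; apply/funext => s; rewrite /= /pull /=. rewrite mapK //= [f (map g s) + _]addrC.
  exact: addrr_bool.
have swap f : (f \+ pull g1 f) \+ pull g2 (f \+ pull g1 f) =
              (f \+ pull g2 f) \+ pull g1 (f \+ pull g2 f).
  apply/funext => s; rewrite /= /pull /= addrACA; congr (_ + (_ + f _)).
  by rewrite -!map_comp; apply: eq_map => v; rewrite /= g12.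
have addK g f : (cobd f) \+ pull g (cobd f) = cobd (f \+ pull g f).
  by apply/funext => s; rewrite cobdD cobd_pull.
rewrite cellE; set psi := prefix_by (b p q) phi.
(* By the cone formula the base contributes the wanted value; the rest is [psi] evaluated on the
   boundary of the base and must vanish. *)
rewrite -[prefix_by _ _]/(phi \+ cobd psi) cell_bdD -[RHS]addr0; congr (_ + _).
rewrite /cell_bd !addK.
case: p q pqn {psi}(psi) => [|p] [|q] pqn psi //.
- rewrite add0r IHn ?sq0 //; last by case: pqn.
  rewrite /cell_bd; case: q pqn => [|q] pqn.
    by rewrite addr0 /pull /= addrr_bool.
  by rewrite add0r sq0 ?cell0.
- rewrite addr0 IHn ?sq0 //; last by case: pqn.
  rewrite /cell_bd; case: p pqn => [|p] pqn.
    by rewrite addr0 /pull /= addrr_bool.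
  by rewrite addr0 sq0 ?cell0.
- rewrite !IHn; [|by case: pqn; rewrite addnS|by case: pqn].
  rewrite /cell_bd !sq0 // swap.
  case: p q {pqn} => [|p] [|q] /=; rewrite ?cell0 ?add0r ?addr0 //;
    exact: addrr_bool.
Qed.

End Staircase.

Section IteratedSubdivision.
Context (V : eqType) (bary : seq V -> V).
Implicit Types (phi psi : seq V -> bool) (g : V -> V) (v : V) (s t : seq V).

Lemma iter_sdD r phi psi :
  iter r (sd bary) (phi \+ psi) = iter r (sd bary) phi \+ iter r (sd bary) psi.
Proof. by elim: r => //= r ->; rewrite sdD. Qed.

Lemma iter_sd_cobd r phi : iter r (sd bary) (cobd phi) = cobd (iter r (sd bary) phi).
Proof. by elim: r => //= r ->; rewrite sd_cobd. Qed.

Lemma iter_sd_pull r g phi : (forall s, bary (map g s) = g (bary s)) ->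
  iter r (sd bary) (pull g phi) = pull g (iter r (sd bary) phi).
Proof. by move=> barg; elim: r => //= r ->; rewrite sd_pull. Qed.

Lemma iter_sd_ext r (C : V -> Prop) phi psi s :
    (forall t, t != [::] -> (forall v, v \in t -> C v) -> C (bary t)) ->
    (forall v, v \in s -> C v) ->
    (forall t, size t = size s -> (forall v, v \in t -> C v) -> phi t = psi t) ->
  iter r (sd bary) phi s = iter r (sd bary) psi s.
Proof.
move=> barC; elim: r s => [|r IHr] s Cs eq_phi; first exact: eq_phi.
apply: (sd_ext barC) => // t ts Ct; apply: IHr => // u ut Cu.
by apply: eq_phi; rewrite // ut.
Qed.

Lemma iter_sd_vertex r phi v : (forall w, phi [:: w] = 1) ->
  iter r (sd bary) phi [:: v] = 1.
Proof.
move=> phi1; elim: r v => [|r IHr] v //=.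
by rewrite sdE //= addr0 /prefix_by sd_nil IHr.
Qed.

End IteratedSubdivision.

(** The coboundary of each [F i] is [g]-invariant, because [g] changes [F i] by the constant
    [a i]. *)
Lemma cup_map (V : eqType) (F : nat -> V -> bool) (a : nat -> bool) (g : V -> V) r s :
    (forall i v, v \in s -> F i (g v) = F i v + a i) ->
  cup (map F r) (map g s) = cup (map F r) s.
Proof.
elim: r s => [|i r IHr] [|v [|w s]] //= Fg.
have Fi u : u \in [:: v, w & s] -> F i (g u) = F i u + a i by exact: Fg.
rewrite [F i (g v)]Fi ?mem_head // [F i (g w)]Fi ?inE ?eqxx ?orbT //.
rewrite -[_ :: map g s]/(map g (w :: s)) IHr; last first.
  by move=> j u us; apply: Fg; rewrite in_cons us orbT.
by rewrite addrACA addrr_bool addr0.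
Qed.

(** * Evaluation of the cup product by Stokes' formula and Pascal's rule *)

Section PrismCup.
Context (V : eqType) (bary : seq V -> V) (g1 g2 : V -> V) (b : nat -> nat -> V).
Hypotheses (g1K : involutive g1) (g2K : involutive g2).
Hypothesis g12 : forall v, g1 (g2 v) = g2 (g1 v).
Hypothesis bary_g1 : forall s, bary (map g1 s) = g1 (bary s).
Hypothesis bary_g2 : forall s, bary (map g2 s) = g2 (bary s).
Context (U : V -> Prop) (P Q l : nat) (F : nat -> V -> bool).
Hypothesis F_g1 : forall i v, U v -> F i (g1 v) = F i v + (i < l)%N.
Hypothesis F_g2 : forall i v, U v -> F i (g2 v) = F i v + true.
(** [C] stands for a convex set; it keeps the subdivided simplices inside [U], where the sign rules
    [F_g1] and [F_g2] apply. *)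
Hypothesis hull : forall p q s, (p <= P)%N -> (q <= Q)%N ->
  staircase g1 g2 b p q s ->
  exists C : V -> Prop, [/\ forall v, v \in s -> C v, forall v, C v -> U v &
    forall t, t != [::] -> (forall v, v \in t -> C v) -> C (bary t)].

(** [g] fixes [cup (map F js)] and adds [a i] to [F i], so the primitive plus its pullback is [a i]
    times the cocycle. *)
Lemma cell_primitive r p q g (a : nat -> bool) i js :
    (p <= P)%N -> (q <= Q)%N -> (forall s, bary (map g s) = g (bary s)) ->
    (forall j v, U v -> F j (g v) = F j v + a j) ->
  let psi := iter r (sd bary) (cup_primitive (F i) (map F js)) in
  cell g1 g2 b p q (psi \+ pull g psi) =
    a i * cell g1 g2 b p q (iter r (sd bary) (cup (map F js))).
Proof.
move=> leP leQ barg Fg psi; rewrite -iter_sd_pull // -iter_sdD.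
transitivity (cell g1 g2 b p q
   (iter r (sd bary) (if a i then cup (map F js) else fun=> 0))); last first.
  case: (a i); first by rewrite mul1r.
  rewrite mul0r; transitivity (cell g1 g2 b p q (fun=> 0)); last exact: cell0.
  apply: cell_ext => s _; elim: r {psi} s => //= r IHr s.
  (* Zero is written as a double, and [sd] is additive. *)
  rewrite -[RHS](addrr_bool (sd bary (iter r (sd bary) (fun=> 0)) s)).
  rewrite -[RHS]/((sd bary _ \+ sd bary _) s) -sdD; congr sd.
  by apply/funext => t /=; rewrite IHr.
apply: cell_ext => s sts; have [C [Cs CU barC]] := hull leP leQ sts.
apply: (iter_sd_ext _ barC) => // -[_ _|v t _ Ct].
  by rewrite /= /pull /=; case: (a i); case: (js).
have Fv : F i (g v) = F i v + a i by rewrite Fg //; apply/CU/Ct/mem_head.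
have cupg : cup (map F js) (map g (v :: t)) = cup (map F js) (v :: t).
  by apply: (@cup_map _ _ a) => j w /Ct/CU; exact: Fg.
rewrite /= /pull /= in cupg *; rewrite cupg -mulrDl Fv addrA addrr_bool add0r.
by case: (a i); rewrite ?mul1r ?mul0r.
Qed.

(** Induction on the number of factors. By Stokes the first coboundary is moved to the sides of
    [c_(p,q)]; the [g1] sides count only if [i < l], the [g2] sides always, which is Pascal's rule
    for ['C(l - i, p)]. *)
Lemma cell_cup r i t p q :
    (p <= P)%N -> (q <= Q)%N -> (p + q)%N = t -> (l <= i + t)%N ->
  cell g1 g2 b p q (iter r (sd bary) (cup (map F (iota i t)))) = odd 'C(l - i, p).
Proof.
elim: t i p q => [|t IHt] i p q leP leQ pqt lit.
  case: p q pqt {leP leQ} => [|//] [|//] _.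
  by rewrite cellE /cell_bd /= addr0 /prefix_by iter_sd_vertex // bin0.
have -> : cup (map F (iota i t.+1)) =
    cobd (cup_primitive (F i) (map F (iota i.+1 t))).
  by apply/funext => s; rewrite cobd_cup_primitive //; exact: cobd_cup.
rewrite iter_sd_cobd cell_cobd // /cell_bd.
have {}IHt p' q' : (p' <= P)%N -> (q' <= Q)%N -> (p' + q')%N = t ->
    cell g1 g2 b p' q' (iter r (sd bary) (cup (map F (iota i.+1 t)))) =
    odd 'C(l - i.+1, p').
  by move=> leP' leQ' pqt'; apply: IHt => //; rewrite addSnnS.
have stepl p' : p = p'.+1 -> cell g1 g2 b p' q
    (iter r (sd bary) (cup_primitive (F i) (map F (iota i.+1 t))) \+
     pull g1 (iter r (sd bary) (cup_primitive (F i) (map F (iota i.+1 t))))) =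
    (i < l)%N && odd 'C(l - i.+1, p').
  move=> pE; have leP' : (p' <= P)%N by apply: leq_trans leP; rewrite pE.
  rewrite (@cell_primitive r p' q g1 (fun i => (i < l)%N)) // IHt //.
  by apply: succn_inj; rewrite -pqt pE.
have stepr q' : q = q'.+1 -> cell g1 g2 b p q'
    (iter r (sd bary) (cup_primitive (F i) (map F (iota i.+1 t))) \+
     pull g2 (iter r (sd bary) (cup_primitive (F i) (map F (iota i.+1 t))))) =
    odd 'C(l - i.+1, p).
  move=> qE; have leQ' : (q' <= Q)%N by apply: leq_trans leQ; rewrite qE.
  rewrite (@cell_primitive r p q' g2 (fun=> true)) // IHt ?mul1r //.
  by apply: succn_inj; rewrite -pqt qE addnS.
have bin_split p' : odd 'C(l - i, p'.+1) =
    (i < l)%N && odd 'C(l - i.+1, p') (+) odd 'C(l - i.+1, p'.+1).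
  case: (ltnP i l) => [il | li]; first by rewrite -[in LHS](subnSK il) binS oddD addbC.
  have /eqP-> : (l - i == 0)%N by rewrite subn_eq0.
  by have /eqP-> : (l - i.+1 == 0)%N by rewrite subn_eq0 leqW.
case: p q pqt leP leQ stepl stepr => [|p] [|q] // pqt leP leQ stepl stepr.
- by rewrite (stepr q erefl) !bin0.
(* There are no [g2] sides here; the second term of Pascal's rule is 0 since [l <= i + t.+1]. *)
- rewrite (stepl p erefl) addr0 bin_split [X in _ (+) X](_ : _ = false) ?addbF //.
  rewrite bin_small // ltnS -[p]addn0.
  rewrite leq_subLR addSn addnC -addSn; apply: leq_trans lit _.
  by rewrite -pqt !addn0 addSn addnC addSn.
- by rewrite (stepl p erefl) (stepr q erefl) bin_split.
Qed.

End PrismCup.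

(** * Shrinking of diameters under subdivision *)

Section Mesh.
Context (R : realType) (V : normedModType R).
Implicit Types (s t : seq V) (v w c : V) (D e : R).

Definition barycenter s : V := (size s)%:R^-1 *: \sum_(v <- s) v.

Definition diam_le D s := forall v w, v \in s -> w \in s -> `|v - w| <= D.

Lemma sub_barycenter c s : s != [::] ->
  c - barycenter s = (size s)%:R^-1 *: \sum_(v <- s) (c - v).
Proof.
move=> s0; have n0 : (size s)%:R != 0 :> R by rewrite pnatr_eq0 size_eq0.
rewrite sumrB big_const_seq count_predT iter_addr_0 scalerBr; congr (_ - _).
by rewrite -[c *+ _]scaler_nat scalerA mulVf // scale1r.
Qed.

Lemma barycenter_ball c e s : s != [::] ->
  (forall v, v \in s -> `|c - v| <= e) -> `|c - barycenter s| <= e.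
Proof.
move=> s0 cs; have n0 : 0 < (size s)%:R :> R by rewrite ltr0n lt0n size_eq0.
rewrite sub_barycenter // normrZ ger0_norm ?invr_ge0 ?ler0n // ler_pdivrMl //.
apply: le_trans (ler_norm_sum _ _ _) _; rewrite big_seq.
apply: (@le_trans _ _ (\sum_(v <- s | v \in s) e)).
  by apply: ler_sum => v; exact: cs.
by rewrite -big_seq big_const_seq count_predT iter_addr_0 mulr_natl.
Qed.

(** The average defining [v - barycenter s] contains the zero term [v - v], so at most [size s - 1]
    of its [size s] terms contribute, a share of at most [M%:R / M.+1%:R]. *)
Lemma barycenter_vertex M D s v : v \in s -> (size s <= M.+1)%N -> diam_le D s ->
  `|v - barycenter s| <= M%:R / M.+1%:R * D.
Proof.
move=> vs sM sD; have s0 : s != [::] by case: s vs {sM sD}.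
have D0 : 0 <= D by have := sD v v vs vs; rewrite subrr normr0.
have n0 : 0 < (size s)%:R :> R by rewrite ltr0n lt0n size_eq0.
rewrite sub_barycenter // normrZ ger0_norm ?invr_ge0 ?ler0n // ler_pdivrMl //.
apply: le_trans (ler_norm_sum _ _ _) _; rewrite (big_rem v) //= subrr normr0 add0r.
apply: (@le_trans _ _ (\sum_(w <- rem v s) D)).
  rewrite big_seq [leRHS]big_seq; apply: ler_sum => w /mem_rem; exact: sD.
rewrite big_const_seq count_predT iter_addr_0 size_rem // -[D *+ _]mulr_natl mulrA.
apply: ler_wpM2r => //; rewrite mulrA ler_pdivlMr ?ltr0n //.
rewrite -!natrM ler_nat; case: (size s) sM => [|k] //= kM.
by rewrite mulSn mulnS leq_add2r.
Qed.

(** Each simplex of the subdivision is [barycenter s] followed by a simplex of a subdivided face, so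
    its diameter is controlled by the distance to the barycenter and, inductively, by the face. *)
Lemma sd_small M D (C : V -> Prop) (phi : seq V -> bool) s :
    (forall t, t != [::] -> (forall v, v \in t -> C v) -> C (barycenter t)) ->
    (forall v, v \in s -> C v) -> (size s <= M.+1)%N -> diam_le D s -> 0 <= D ->
    (forall t, size t = size s -> (forall v, v \in t -> C v) ->
       diam_le (M%:R / M.+1%:R * D) t -> phi t = 0) ->
  sd barycenter phi s = 0.
Proof.
move=> + + + + D0; move: {2}(size s) (erefl (size s)) => n.
elim: n s C phi => [|n IHn] s C phi sn barC Cs sM sD phi0.
  by move/size0nil: sn phi0 => -> phi0; rewrite sd_nil phi0.
have s0 : s != [::] by rewrite -size_eq0 sn.
rewrite sdE // -[RHS](cobd0 s).
apply: cobd_ext => t st ts.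
(* Adding the ball around the barycenter to the convex class keeps the cone point close to all later
   vertices. *)
pose C' v := C v /\ `|barycenter s - v| <= M%:R / M.+1%:R * D.
apply: (IHn t C') => [|u u0 Cu|v vt||v w vt wt|u ut Cu uD].
- by apply: succn_inj; rewrite -st.
- split; first by apply: barC => // v /Cu[].
  by apply: barycenter_ball => // v /Cu[].
- split; first by apply/Cs/ts.
  by rewrite distrC; apply: barycenter_vertex; rewrite ?ts.
- by apply: leq_trans sM; rewrite st.
- by apply: sD; exact: ts.
apply: phi0 => [|v|v w].
- by rewrite /= st ut.
- by rewrite inE => /orP[/eqP->|/Cu[]//]; exact: barC.
have MD0 : 0 <= M%:R / M.+1%:R * D by rewrite mulr_ge0 ?divr_ge0.
rewrite !inE => /orP[/eqP->|vu] /orP[/eqP->|wu].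
- by rewrite subrr normr0.
- by have [] := Cu _ wu.
- by rewrite distrC; have [] := Cu _ vu.
- exact: uD.
Qed.

Lemma iter_sd_small r M D (C : V -> Prop) (phi : seq V -> bool) s :
    (forall t, t != [::] -> (forall v, v \in t -> C v) -> C (barycenter t)) ->
    (forall v, v \in s -> C v) -> (size s <= M.+1)%N -> diam_le D s -> 0 <= D ->
    (forall t, size t = size s -> (forall v, v \in t -> C v) ->
       diam_le ((M%:R / M.+1%:R) ^+ r * D) t -> phi t = 0) ->
  iter r (sd barycenter) phi s = 0.
Proof.
move=> barC; elim: r s D => [|r IHr] s D Cs sM sD D0 phi0.
  by apply: phi0 => //; rewrite expr0 mul1r.
rewrite /=; apply: (sd_small barC Cs sM sD D0) => t ts Ct tD.
apply: (IHr _ _ Ct _ tD) => [||u ut Cu uD]; first by rewrite ts.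
  by rewrite mulr_ge0 ?divr_ge0.
by apply: phi0 => //; [rewrite ut | rewrite exprSr -mulrA].
Qed.

End Mesh.

Lemma expr_ratio_small (R : realType) M (D e : R) : 0 < e ->
  exists r, (M%:R / M.+1%:R) ^+ r * D < e.
Proof.
move=> e0; set k : R := _ / _.
have k1 : `|k| < 1.
  by rewrite ger0_norm ?divr_ge0 // ltr_pdivrMr ?ltr0n // mul1r ltr_nat.
have : k ^+ r * D @[r --> \oo] --> (0 * D : R).
  by apply: cvgM; [exact: cvg_expr | exact: cvg_cst].
rewrite mul0r => /cvgr_lt/(_ _ e0) [r _ /(_ r (leqnn r)) kr].
by exists r.
Qed.

(** * Zeros of biequivariant maps *)

Section CrossPolytope.
Context (R : realType) (k : nat).
Implicit Types (e : nat -> bool) (p : nat) (y : 'rV[R]_k).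

(** The 1-norm makes this the boundary of the cross-polytope, whose faces are convex and avoid 0. *)
Definition cross_sphere : set 'rV[R]_k := [set y | \sum_i `|y 0 i| = 1].

Lemma cross_sphere_neq0 y : cross_sphere y -> y != 0.
Proof.
move=> y1; apply/eqP => y0; move: y1; rewrite /cross_sphere /= y0.
rewrite big1 => [/esym/eqP|i _]; first by rewrite oner_eq0.
by rewrite mxE normr0.
Qed.

Lemma cross_sphere_compact : compact cross_sphere.
Proof.
apply: bounded_closed_compact.
  exists 1; split => // M M1 y y1 /=; apply: le_trans (ltW M1).
  rewrite [leLHS]/Num.Def.normr /= mx_normrE; apply: bigmax_le => // -[a i] _ /=.
  rewrite ord1 -y1 (bigD1 i) //= lerDl; exact: sumr_ge0.
apply: (@preimage_closed _ _ (fun y : 'rV[R]_k => \sum_i `|y 0 i|) [set 1]); last first.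
  exact: closed_eq.
move=> y _; apply: continuous_big => [|i _].
  exact: add_continuous.
move=> {}y; apply: (@continuous_comp _ _ _ (fun y : 'rV[R]_k => y 0 i) Num.norm).
  exact: coord_continuous.
exact: norm_continuous.
Qed.

(** The face of the cross-polytope in the orthant with sign pattern [e], on the coordinates up to
    [p]. *)
Definition facet e p y :=
  [/\ forall i : 'I_k, 0 <= (-1) ^+ (e i) * y 0 i,
      \sum_(i < k) (-1) ^+ (e i) * y 0 i = 1 &
      forall i : 'I_k, (p < i)%N -> y 0 i = 0].

Lemma facet_cross_sphere e p y : facet e p y -> cross_sphere y.
Proof.
move=> [y0 y1 _]; rewrite /cross_sphere /= -[RHS]y1; apply: eq_bigr => i _.
by rewrite -[RHS]ger0_norm // normrM normr_sign mul1r.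
Qed.

Lemma barycenter_coord (s : seq 'rV[R]_k) i :
  barycenter s 0 i = (size s)%:R^-1 * \sum_(y <- s) y 0 i.
Proof. by rewrite mxE summxE. Qed.

Lemma facet_barycenter e p (s : seq 'rV[R]_k) : s != [::] ->
  (forall y, y \in s -> facet e p y) -> facet e p (barycenter s).
Proof.
move=> s0 sf; have n0 : (size s)%:R != 0 :> R by rewrite pnatr_eq0 size_eq0.
split=> [i||i pi].
- rewrite barycenter_coord mulrCA mulr_ge0 ?invr_ge0 // mulr_sumr big_seq.
  by apply: sumr_ge0 => y /sf[].
- transitivity ((size s)%:R^-1 * \sum_(y <- s) \sum_(i < k) (-1) ^+ (e i) * y 0 i).
    rewrite exchange_big mulr_sumr; apply: eq_bigr => i _.
    by rewrite barycenter_coord mulrCA mulr_sumr.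
  rewrite big_seq (eq_bigr (fun=> 1)) => [|y /sf[]//].
  by rewrite -big_seq big_const_seq count_predT iter_addr_0 mulVf.
- rewrite barycenter_coord big_seq big1 ?mulr0 // => y /sf[_ _]; exact.
Qed.

Lemma facetN e p y : facet e p y -> facet (fun i => ~~ e i) p (- y).
Proof.
move=> [y0 y1 yp]; split=> [i||i pi].
- by rewrite mxE signrN mulrNN.
- by rewrite -[RHS]y1; apply: eq_bigr => i _; rewrite mxE signrN mulrNN.
- by rewrite mxE yp // oppr0.
Qed.

(** The sign at [p.+1] is free since [y] vanishes there; resetting it to plus makes room for the
    vertex [evec p.+1]. *)
Lemma facetS e p y : facet e p y -> facet (fun i => (i != p.+1) && e i) p.+1 y.
Proof.
have E (i : 'I_k) : facet e p y ->
    (-1) ^+ ((i != p.+1 :> nat) && e i) * y 0 i = (-1) ^+ (e i) * y 0 i.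
  by case: eqP => // ip [_ _ yp]; rewrite yp ?ip // !mulr0.
move=> yf; have [y0 y1 yp] := yf; split=> [i||i pi].
- by rewrite E.
- by rewrite -[RHS]y1; apply: eq_bigr => i _; rewrite E.
- by rewrite yp // ltnW.
Qed.

Definition evec p : 'rV[R]_k := \row_(j < k) (j == p :> nat)%:R.

Lemma facet_evec e p : (p < k)%N -> e p = false -> facet e p (evec p).
Proof.
move=> pk ep; have E (i : 'I_k) : (-1) ^+ (e i) * evec p 0 i = (i == Ordinal pk)%:R.
  by rewrite mxE -val_eqE /=; case: eqP => [->|]; rewrite ?ep ?mul1r ?mulr0.
split=> [i||i pi].
- by rewrite E ler0n.
- rewrite (eq_bigr _ (fun i _ => E i)) (bigD1 (Ordinal pk)) //= eqxx.
  by rewrite big1 ?addr0 // => i /negPf->.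
- by rewrite mxE gtn_eqF.
Qed.

(** An odd choice of sign for nonzero vectors, with which ties at zeros of [f i] will be broken. *)
Definition lead_neg y : bool := if [pick i | y 0 i != 0] is Some i then y 0 i < 0 else false.

Lemma lead_negN y : y != 0 -> lead_neg (- y) = lead_neg y + true.
Proof.
move=> y0; rewrite /lead_neg.
rewrite (@eq_pick _ (fun i => (- y) 0 i != 0) (fun i => y 0 i != 0)); last first.
  by move=> i; rewrite /= mxE oppr_eq0.
case: pickP => [i yi0|y00]; first by rewrite mxE oppr_lt0; case: ltrgtP yi0.
by case/eqP: y0; apply/rowP => i; rewrite mxE; have /negbFE/eqP := y00 i.
Qed.

End CrossPolytope.

Lemma cup_locally_const (V : eqType) (F : nat -> V -> bool) js i (s : seq V) :
    i \in js -> (forall v w, v \in s -> w \in s -> F i v = F i w) ->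
  cup (map F js) s = 0.
Proof.
elim: js s => // j js IHjs [|v [|w s]] //= ijs Fi.
move: ijs; rewrite inE => /orP[/eqP<- | ijs].
  by rewrite (Fi v w) ?addrr_bool ?mul0r ?inE ?eqxx ?orbT.
rewrite (IHjs (w :: s) ijs) ?mulr0 // => x y xs ys.
by apply: Fi; rewrite in_cons ?xs ?ys orbT.
Qed.

(** * Nonvanishing biequivariant maps force an even binomial coefficient *)

Section BiequivariantZero.
Context (R : realType) (k n m l : nat).
Local Notation V := ('rV[R]_k * 'rV[R]_n.+1)%type.
Hypotheses (mk : (m < k)%N) (lmn : (l <= m + n)%N).
Context (f : nat -> V -> R).
Hypothesis f_negl : forall i y x, y != 0 -> x != 0 ->
  f i (- y, x) = (-1) ^+ (i < l)%N * f i (y, x).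
Hypothesis f_negr : forall i y x, y != 0 -> x != 0 ->
  f i (y, - x) = - f i (y, x).
Hypothesis f_cont : forall i y x, y != 0 -> x != 0 ->
  {for (y, x), continuous (f i)}.
Hypothesis f_nz : forall y x, y != 0 -> x != 0 ->
  exists2 i, (i < m + n)%N & f i (y, x) != 0.

Let K : set V := @cross_sphere R k `*` @cross_sphere R n.+1.

Let K_compact : compact K.
Proof. by apply: compact_setX; exact: cross_sphere_compact. Qed.

(** A Lebesgue number: at each point of [K] some coordinate is nonzero, hence keeps its sign on a
    ball, and compactness makes the radius uniform. *)
Let lebesgue : exists2 e : R, 0 < e & forall v, K v -> exists2 i, (i < m + n)%N &
  (forall w, `|v - w| < e -> 0 < f i w) \/ (forall w, `|v - w| < e -> f i w < 0).
Proof.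
pose good (e : R) (v : V) := exists2 i, (i < m + n)%N &
  (forall w, `|v - w| < e -> 0 < f i w) \/ (forall w, `|v - w| < e -> f i w < 0).
suff : \forall e \near 0^'+, K `<=` good e.
  by move=> H; near (0 : R)^'+ => e; exists e; [near: e; exact: nbhs_right_gt|near: e].
apply: (iffLR (compact_near_coveringP K) K_compact _ _ good) => -[y x].
case=> /= /cross_sphere_neq0 y0 /cross_sphere_neq0 x0.
have [i imn fi0] := f_nz y0 x0.
suff [d d0 dP] : exists2 d, 0 < d &
    (forall w, `|(y, x) - w| < d -> 0 < f i w) \/
    (forall w, `|(y, x) - w| < d -> f i w < 0).
  (* Half of the radius is spent on moving the centre to [v], half on the new ball. *)
  near=> v e; exists i => //.
  have vd : `|(y, x) - v| < d / 2.
    by near: v; apply: cvgr_dist_lt; rewrite ?divr_gt0.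
  have ed : e < d / 2 by near: e; apply: nbhs_right_lt; rewrite divr_gt0.
  case: dP => dP; [left | right] => w vw; apply: dP;
    by rewrite -[X in `|X|](subrKA v) [d]splitr (le_lt_trans (ler_normD _ _)) // ltrD //
      (lt_trans vw).
move: fi0; rewrite neq_lt => /orP[fi0|fi0].
  have /nbhs_normP[d d0 dP] : \forall w \near ((y, x) : V), f i w < 0.
    exact: (@cvgr_lt R V _ _ (f i) _ (f_cont y0 x0) _ fi0).
  by exists d => //; right => w wd; apply: dP; rewrite /= /ball_.
have /nbhs_normP[d d0 dP] : \forall w \near ((y, x) : V), f i w > 0.
    exact: (@cvgr_gt R V _ _ (f i) _ (f_cont y0 x0) _ fi0).
by exists d => //; left => w wd; apply: dP.
Unshelve. all: by end_near. Qed.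

(** At zeros of [f i] the odd signs of the two factors fill in, so that the sign rules under both
    antipodes hold on all of [U]. *)
Let F (i : nat) (v : V) : bool :=
  if f i v == 0 then (i < l)%N && lead_neg v.1 (+) lead_neg v.2 else f i v < 0.

Let gl (v : V) : V := (- v.1, v.2).
Let gr (v : V) : V := (v.1, - v.2).
Let U (v : V) := v.1 != 0 /\ v.2 != 0.
(** With these cone points [c_(p,q)] is carried by a product of hemispheres of dimensions [p] and
    [q]. *)
Let b p q : V := (evec R k p, evec R n.+1 q).

Let F_gl i v : U v -> F i (gl v) = F i v + (i < l)%N.
Proof.
case: v => y x [/= y0 x0]; rewrite /F /gl /= f_negl // mulf_eq0 signr_eq0 /=.
case: eqP => [_|/eqP fi0].
  by rewrite lead_negN //; case: (i < l)%N; case: lead_neg; case: lead_neg.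
case: (i < l)%N; last by rewrite mul1r addr0.
by rewrite mulN1r oppr_lt0; case: ltrgtP fi0.
Qed.

Let F_gr i v : U v -> F i (gr v) = F i v + true.
Proof.
case: v => y x [/= y0 x0]; rewrite /F /gr /= f_negr // oppr_eq0.
case: eqP => [_|/eqP fi0].
  by rewrite lead_negN //; case: (_ && _); case: lead_neg.
by rewrite oppr_lt0; case: ltrgtP fi0.
Qed.

Let barycenter_pair (s : seq V) :
  barycenter s = (barycenter (map fst s), barycenter (map snd s)).
Proof.
rewrite /barycenter !size_map !big_map.
suff -> : \sum_(v <- s) v = (\sum_(v <- s) v.1, \sum_(v <- s) v.2) by [].
by elim: s => [|v s IHs]; rewrite ?big_nil ?big_cons ?IHs.
Qed.

Let barycenter_gl s : barycenter (map gl s) = gl (barycenter s).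
Proof.
rewrite !barycenter_pair -!map_comp /gl /=; congr (_, _).
by rewrite /barycenter !size_map !big_map -scalerN -sumrN.
Qed.

Let barycenter_gr s : barycenter (map gr s) = gr (barycenter s).
Proof.
rewrite !barycenter_pair -!map_comp /gr /=; congr (_, _).
by rewrite /barycenter !size_map !big_map -scalerN -sumrN.
Qed.

(** Induction along the staircase. The next cone point keeps one of its two components; the plus
    signs at [p] and [q] ensure that this component lies in the current face. *)
Let staircase_facet p q s : staircase gl gr b p q s -> (p < k)%N -> (q < n.+1)%N ->
  exists e1 e2, [/\ e1 p = false, e2 q = false &
    forall v, v \in s -> facet e1 p v.1 /\ facet e2 q v.2].
Proof.
elim=> {p q s} [|p q s _ IH|p q s _ IH|p q s _ IH|p q s _ IH] pk qn.
- exists (fun=> false), (fun=> false); split => // v /[!inE]/eqP->.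
  by split; exact: facet_evec.
- have [e1 [e2 [e1p e2q sf]]] := IH (ltnW pk) qn.
  exists (fun i => (i != p.+1) && e1 i), e2; split=> [|//|v].
    by rewrite eqxx.
  rewrite inE => /orP[/eqP->|/sf[sf1 sf2]]; split=> //=.
  + by apply: facet_evec; rewrite ?eqxx.
  + exact: facet_evec.
  + exact: facetS.
- have [e1 [e2 [e1p e2q sf]]] := IH (ltnW pk) qn.
  exists (fun i => (i != p.+1) && ~~ e1 i), e2; split=> [|//|v].
    by rewrite eqxx.
  rewrite inE => /orP[/eqP->|/mapP[{}v /sf[sf1 sf2] ->]]; split=> //=.
  + by apply: facet_evec; rewrite ?eqxx.
  + exact: facet_evec.
  + exact/facetS/facetN.
- have [e1 [e2 [e1p e2q sf]]] := IH pk (ltnW qn).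
  exists e1, (fun i => (i != q.+1) && e2 i); split=> [//||v].
    by rewrite eqxx.
  rewrite inE => /orP[/eqP->|/sf[sf1 sf2]]; split=> //=.
  + exact: facet_evec.
  + by apply: facet_evec; rewrite ?eqxx.
  + exact: facetS.
- have [e1 [e2 [e1p e2q sf]]] := IH pk (ltnW qn).
  exists e1, (fun i => (i != q.+1) && ~~ e2 i); split=> [//||v].
    by rewrite eqxx.
  rewrite inE => /orP[/eqP->|/mapP[{}v /sf[sf1 sf2] ->]]; split=> //=.
  + exact: facet_evec.
  + by apply: facet_evec; rewrite ?eqxx.
  + exact/facetS/facetN.
Qed.

Let staircase_hull p q s : (p <= m)%N -> (q <= n)%N -> staircase gl gr b p q s ->
  exists C : V -> Prop, [/\ forall v, v \in s -> C v, forall v, C v -> K v &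
    forall t, t != [::] -> (forall v, v \in t -> C v) -> C (barycenter t)].
Proof.
move=> pm qn sts; have pk := leq_ltn_trans pm mk.
have [e1 [e2 [_ _ sf]]] := staircase_facet sts pk qn.
exists (fun v => facet e1 p v.1 /\ facet e2 q v.2); split=> //.
  by move=> v [/facet_cross_sphere v1 /facet_cross_sphere v2].
move=> t t0 tf; rewrite barycenter_pair.
by split; apply: facet_barycenter; rewrite -?size_eq0 ?size_map ?size_eq0 //=;
  move=> _ /mapP[v /tf[vf1 vf2] ->].
Qed.

Let K_U v : K v -> U v.
Proof. by case=> /cross_sphere_neq0 v1 /cross_sphere_neq0. Qed.

Lemma even_bin_of_nonvanishing : odd 'C(l, m) = false.
Proof.
have hullU p q s : (p <= m)%N -> (q <= n)%N -> staircase gl gr b p q s ->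
    exists C : V -> Prop, [/\ forall v, v \in s -> C v, forall v, C v -> U v &
      forall t, t != [::] -> (forall v, v \in t -> C v) -> C (barycenter t)].
  move=> pm qn /(staircase_hull pm qn)[C [Cs CK Cb]].
  by exists C; split=> // v /CK/K_U.
have [e e0 eK] := lebesgue.
have [D0 [_ KD]] := compact_bounded K_compact.
pose D := `|D0| + 1.
have {}KD v : K v -> `|v| <= D.
  apply: KD; rewrite /D (le_lt_trans (ler_norm _)) // ltrDl //.
(* The simplices of [c_(m,n)] have [m + n + 1] vertices and diameter at most [D + D]; [r]
   subdivisions bring them below the Lebesgue number [e]. *)
have [r rD] := @expr_ratio_small R (m + n) (D + D) e e0.
have <- : cell gl gr b m n (iter r (sd (@barycenter R V))
    (cup (map F (iota 0 (m + n))))) = odd 'C(l, m).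
  rewrite -[in RHS](subn0 l); 
  apply: (cell_cup _ _ _ barycenter_gl barycenter_gr F_gl F_gr hullU) => //.
  - by move=> [y x]; rewrite /gl /= opprK.
  - by move=> [y x]; rewrite /gr /= opprK.
(* Second evaluation: on each small simplex some [f i] has constant sign, so the cup product is
   0. *)
apply: etrans (cell0 gl gr b m n).
apply: cell_ext => s sts; have [C [Cs CK Cb]] := staircase_hull (leqnn m) (leqnn n) sts.
apply: (iter_sd_small (M := m + n) (D := D + D) Cb Cs).
- by rewrite (size_staircase sts).
- move=> v w /Cs/CK/KD vD /Cs/CK/KD wD; apply: le_trans (ler_normB _ _) _.
  exact: lerD.
- by rewrite addr_ge0 // addr_ge0.
case=> [|v t] ts Ct tD; first by rewrite (size_staircase sts) in ts.
have [i imn vi] := eK v (CK _ (Ct _ (mem_head _ _))).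
apply: (cup_locally_const (i := i)); first by rewrite mem_iota.
have near_v w : w \in v :: t -> `|v - w| < e.
  by move=> wt; apply: le_lt_trans rD; apply: tD; rewrite ?mem_head.
suff : exists c, forall w, w \in v :: t -> F i w = c.
  by move=> [c Fc] w w' wt wt'; rewrite !Fc.
case: vi => vi; [exists false | exists true] => w /near_v/vi fi; rewrite /F.
  by rewrite gt_eqF // ltNge ltW.
by rewrite lt_eqF.
Qed.

End BiequivariantZero.

(** * Parity of binomial coefficients *)

(** The last-digit case of Lucas' theorem, by Pascal's rule mod 2. *)
Lemma odd_bin_double a c :
  [/\ odd 'C(a.*2, c.*2) = odd 'C(a, c), odd 'C(a.*2, c.*2.+1) = false,
      odd 'C(a.*2.+1, c.*2) = odd 'C(a, c) & odd 'C(a.*2.+1, c.*2.+1) = odd 'C(a, c)].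
Proof.
have even_odd : forall c, odd 'C(a.*2, c.*2) = odd 'C(a, c) /\ odd 'C(a.*2, c.*2.+1) = false.
  elim: a {c} => [|a IHa] c; first by case: c.
  split; last first.
    case: c => [|c]; first by rewrite double0 bin1 odd_double.
    have [E1 E2] := IHa c; have [E3 E4] := IHa c.+1.
    by rewrite !doubleS !binS !oddD -doubleS E2 E3 E4; case: (odd _).
  case: c => [|c]; first by rewrite !bin0.
  have [E1 E2] := IHa c; have [E3 E4] := IHa c.+1.
  rewrite !doubleS !binS !oddD -doubleS E1 E2 E3 addbF.
  by case: (odd 'C(a, c)); case: (odd 'C(a, c.+1)).
have [E1 E2] := even_odd c; split=> //.
- case: c {E1 E2} => [|c]; first by rewrite !bin0.
  have [E1 E2] := even_odd c; have [E3 E4] := even_odd c.+1.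
  by rewrite doubleS binS oddD -doubleS E3 E2 addbF.
- by rewrite binS oddD E1 E2.
Qed.

Lemma binary_digitS i a : binary_digit i.+1 a = binary_digit i a./2.
Proof. by rewrite /binary_digit expnS divnMA divn2. Qed.

(** Lucas' theorem: halving strips the last binary digits, which add without carry as they are not
    both one. *)
Lemma odd_bin_no_common_one a b : ~ share_common_one a b -> odd 'C(a + b, a).
Proof.
have [n] := ubnP (a + b)%N; elim: n a b => // n IHn a b ltn nab.
have nab2 : ~ share_common_one a./2 b./2.
  by move=> [i [ai bi]]; apply: nab; exists i.+1; rewrite !binary_digitS.
have nodd : ~~ (odd a && odd b).
  by apply/negP => /andP[oa ob]; apply: nab; exists 0%N; rewrite /binary_digit !divn1.
case: (posnP (a + b)) => [/eqP|ab0]; first by rewrite addn_eq0 => /andP[/eqP-> /eqP->].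
have /IHn/(_ nab2) IH : (a./2 + b./2 < n)%N by lia.
have [E1 E2 E3 E4] := odd_bin_double (a./2 + b./2) a./2.
rewrite -(odd_double_half a) -(odd_double_half b) addnACA -doubleD.
case: (odd a) (odd b) nodd => [] [] //= _; rewrite ?add0n ?add1n.
- by rewrite E4.
- by rewrite E3.
- by rewrite E1.
Qed.

(** * Continuity and compactness *)

Section SetType.
Context {X : topologicalType} (A : set X).

Lemma set_val_continuous : continuous (set_val : A -> X).
Proof. exact: initial_continuous. Qed.

Lemma continuous_at_set_type {T : topologicalType} (h : T -> A) (x : T) :
  {for x, continuous (set_val \o h)} -> {for x, continuous h}.
Proof.
move=> ch U [? /= [[W oW <-]] /= Whx /filterS]; apply; apply: ch.
exact: open_nbhs_nbhs.
Qed.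

Lemma compact_set_type : compact A -> compact [set: A].
Proof.
move=> /compact_near_coveringP cA; apply/compact_near_coveringP => I F P FF PF.
have {}cA := cA _ F (fun i x => forall a : A, set_val a = x -> P i a) FF.
apply: filterS (cA _) => [i Pi a _|x Ax]; first exact: Pi (set_valP a) a erefl.
have xA : x \in A by rewrite inE.
have [[/= N1 N2] [[? [[W oW <-]] /= Wx WN1] N2F NP]] := PF (exist _ x xA) Logic.I.
exists (W, N2); first by split => //=; exact: open_nbhs_nbhs.
move=> [z i] [/= Wz N2i] a az; apply: (NP (a, i)); split => //=.
by apply: WN1; rewrite /= az.
Qed.

Lemma hausdorff_set_type : hausdorff_space X -> hausdorff_space A.
Proof.
move=> hX p q pq; apply: val_inj; apply: hX => B C pB qC.
have [a [Ba Ca]] := pq _ _ (set_val_continuous pB) (set_val_continuous qC).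
by exists (set_val a).
Qed.

End SetType.

Lemma compact_locally_compact (X : topologicalType) :
  compact [set: X] -> locally_compact [set: X].
Proof.
move=> cX x _; exists setT; first by rewrite withinET; exact: filterT.
by split => //; exact: closedT.
Qed.

Section Continuity.
Context {R : realType} {T : topologicalType}.
Implicit Types (x : T).

Lemma continuous_at_row n (h : T -> 'rV[R]_n) x :
  (forall i, {for x, continuous (fun z => h z 0 i)}) -> {for x, continuous h}.
Proof.
move=> ch A [P Px PA]; have FF := nbhs_filter x.
suff : nbhs x (fun z => forall i, P 0 i (h z 0 i)).
  by apply: filterS => z Pz; apply: PA => a i; rewrite ord1.
by apply: filter_forall => i; apply: ch; exact: Px.
Qed.

Lemma continuous_at_coord n (h : T -> 'rV[R]_n) x i :
  {for x, continuous h} -> {for x, continuous (fun z => h z 0 i)}.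
Proof.
move=> ch; apply: (@continuous_comp _ _ _ h (fun M : 'rV_n => M 0 i)) => //.
exact: coord_continuous.
Qed.

Lemma continuous_at_sum (I : Type) (r : seq I) (P : pred I) (h : I -> T -> R) x :
  (forall i, {for x, continuous (h i)}) ->
  {for x, continuous (fun z => \sum_(i <- r | P i) h i z)}.
Proof.
by move=> ch; apply: cvg_big => [|i _]; [exact: add_continuous | exact: ch].
Qed.

Lemma continuous_at_prod (I : Type) (r : seq I) (P : pred I) (h : I -> T -> R) x :
  (forall i, {for x, continuous (h i)}) ->
  {for x, continuous (fun z => \prod_(i <- r | P i) h i z)}.
Proof.
by move=> ch; apply: cvg_big => [|i _]; [exact: mul_continuous | exact: ch].
Qed.

Lemma continuous_at_pair {U W : topologicalType} (g : T -> U) (h : T -> W) x :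
  {for x, continuous g} -> {for x, continuous h} ->
  {for x, continuous (fun z => (g z, h z))}.
Proof. by move=> cg ch; exact: cvg_pair. Qed.

Lemma continuous_at_near_eq {U : topologicalType} (h h' : T -> U) x :
  (\forall z \near x, h z = h' z) ->
  {for x, continuous h'} -> {for x, continuous h}.
Proof.
move=> hh' ch'; have FF := nbhs_filter x.
have hx : h x = h' x := nbhs_singleton hh'.
suff : h z @[z --> x] --> h' x by rewrite -hx.
by apply: cvg_trans ch'; apply: near_eq_cvg; apply: filterS hh' => z ->.
Qed.

(** Where [u] vanishes, boundedness of [h] makes the product small, so continuity of [h] matters
    only elsewhere. This serves to extend maps given on faces by 0. *)
Lemma continuous_at_mul_bounded (u h : T -> R) (M : R) x :
  (forall z, `|h z| <= M) -> {for x, continuous u} ->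
  (u x != 0 -> {for x, continuous h}) -> {for x, continuous (u \* h)}.
Proof.
move=> hM cu ch; have [u0|u0] := eqVneq (u x) 0; last first.
  exact: continuousM cu (ch u0).
suff : (u \* h) z @[z --> x] --> (0 : R) by rewrite -(mul0r (h x)) -u0.
have FF := nbhs_filter x.
have M0 : 0 <= M := le_trans (normr_ge0 _) (hM x).
apply/cvgr0Pnorm_lt => e e0; near=> z.
have uz : `|u z| < e / (M + 1).
  near: z; apply: cvgr0_norm_lt; first by rewrite -u0.
  by rewrite divr_gt0 // ltr_wpDl.
rewrite /= normrM; apply: (@le_lt_trans _ _ (`|u z| * (M + 1))).
  by rewrite ler_wpM2l // (le_trans (hM z)) // lerDl.
by rewrite -ltr_pdivlMr // ltr_wpDl.
Unshelve. all: by end_near. Qed.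

End Continuity.

(** * Compactness of the geometric realization *)

Section Realization.
Context (R : realType) (n : nat) (Sigma : simplicial_complex n).

(** Vanishing of monomials expresses the face condition by closed equations. *)
Lemma nonface_prod0 (x : 'rV[R]_n) : vsupport x \in faces Sigma <->
  forall s, s \notin faces Sigma -> \prod_(i in s) x 0 i = 0.
Proof.
split=> [xS s|x0].
  apply: contraNeq => /prodf_neq0 sx; apply: face_sub xS.
  by apply/fintype.subsetP => i /sx; rewrite inE.
apply: contraT => /x0/eqP; apply: contraTT => _.
by apply/prodf_neq0 => i; rewrite inE.
Qed.

Lemma closed_realization_set : closed (@realization_set R n Sigma).
Proof.
have -> : @realization_set R n Sigma =
    \bigcap_(i in [set: 'I_n]) [set x : 'rV[R]_n | 0 <= x 0 i] `&`
    [set x : 'rV[R]_n | \sum_i x 0 i = 1] `&`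
    \bigcap_(s in [set s | s \notin faces Sigma])
      [set x : 'rV[R]_n | \prod_(i in s) x 0 i = 0].
  apply/seteqP; split=> x /=.
    move=> [x0 x1 /nonface_prod0 xS]; split; last exact: xS.
    by split=> // i _; exact: x0.
  by move=> [[x0 x1] xS]; split; [move=> i; exact: x0| |apply/nonface_prod0].
apply: closedI; first apply: closedI.
- apply: closed_bigI => i _.
  apply: (@preimage_closed _ _ (fun x : 'rV[R]_n => x 0 i) [set z | 0 <= z]).
    by move=> x _; exact: coord_continuous.
  exact: closed_ge.
- apply: (@preimage_closed _ _ (fun x : 'rV[R]_n => \sum_i x 0 i) [set 1]).
    by move=> x _; apply: continuous_at_sum => i; exact: coord_continuous.
  exact: closed_eq.
- apply: closed_bigI => s _.
  apply: (@preimage_closed _ _ (fun x : 'rV[R]_n => \prod_(i in s) x 0 i) [set 0]).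
    by move=> x _; apply: continuous_at_prod => i; exact: coord_continuous.
  exact: closed_eq.
Qed.

Lemma compact_realization : compact [set: realization R Sigma].
Proof.
apply: compact_set_type; apply: bounded_closed_compact; last first.
  exact: closed_realization_set.
exists 1; split => // M M1 y [y0 y1 _] /=; apply: le_trans (ltW M1).
rewrite [leLHS]/Num.Def.normr /= mx_normrE; apply: bigmax_le => // -[a i] _ /=.
rewrite ord1 ger0_norm // -y1 (bigD1 i) //= lerDl; exact: sumr_ge0.
Qed.

Lemma hausdorff_realization : hausdorff_space (realization R Sigma).
Proof. by apply: hausdorff_set_type; exact: norm_hausdorff. Qed.

End Realization.

Lemma compact_sphere (R : realType) k : compact [set: sphere R k].
Proof.
apply: compact_set_type; apply: bounded_closed_compact.
  exists 1; split => // M M1 y y1 /=; apply: le_trans (ltW M1).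
  rewrite [leLHS]/Num.Def.normr /= mx_normrE; apply: bigmax_le => // -[a i] _ /=.
  rewrite ord1 -[leRHS](@normr1 R) -ler_sqr ?nnegrE // ?real_normK ?num_real //.
  rewrite expr1n -[leRHS]y1 (bigD1 i) //= lerDl.
  by apply: sumr_ge0 => j _; exact: sqr_ge0.
apply: (@preimage_closed _ _ (fun y : 'rV[R]_k => \sum_i y 0 i ^+ 2) [set 1]).
  move=> x _; apply: continuous_at_sum => i.
  by apply: continuousM; exact: coord_continuous.
exact: closed_eq.
Qed.

(** * The test map *)

Section SoftThreshold.
Context (R : realType) (n : nat).
Implicit Types x u : 'rV[R]_n.

(* The denominator exceeds [n], so that some coordinate of [x != 0] exceeds the
   threshold in absolute value. *)
Definition threshold x : R := (\sum_i `|x 0 i|) / n.+1%:R.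

(** [soft x] and [soft (- x)] are the [u] and [v] fed to [f]. The positive threshold leaves a
    margin: a coordinate that is at most 0 at some [x != 0] stays off the support in a neighbourhood
    of [x]. *)
Definition soft x : 'rV[R]_n := \row_i Num.max 0 (x 0 i - threshold x).

Definition mass u : R := \sum_i u 0 i.

Lemma thresholdN x : threshold (- x) = threshold x.
Proof. by congr (_ / _); apply: eq_bigr => i _; rewrite mxE normrN. Qed.

Lemma threshold_ge0 x : 0 <= threshold x.
Proof. by rewrite divr_ge0 // sumr_ge0. Qed.

Lemma threshold_gt0 x : x != 0 -> 0 < threshold x.
Proof.
move=> x0; rewrite lt_neqAle threshold_ge0 andbT eq_sym mulf_neq0 ?invr_eq0 ?pnatr_eq0 //.
apply: contra x0 => /eqP xs; apply/eqP/rowP => i; rewrite mxE.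
exact/normr0_eq0/(psumr_eq0P (fun j _ => normr_ge0 _) xs).
Qed.

Lemma soft_ge0 x i : 0 <= soft x 0 i.
Proof. by rewrite mxE le_max lexx. Qed.

Lemma soft_neq0 x i : (soft x 0 i != 0) = (threshold x < x 0 i).
Proof.
rewrite mxE; case: (ltrP 0 (x 0 i - threshold x)) => [xi|].
  by rewrite gt_eqF // -subr_gt0 xi.
by rewrite eqxx subr_le0 leNgt => /negbTE->.
Qed.

Lemma mass_soft_ge0 x : 0 <= mass (soft x).
Proof. by apply: sumr_ge0 => i _; exact: soft_ge0. Qed.

Lemma mass_soft_eq0 x : mass (soft x) = 0 -> forall i, x 0 i <= threshold x.
Proof.
move=> xs i; rewrite leNgt -soft_neq0.
by rewrite (psumr_eq0P (fun j _ => soft_ge0 x j) xs) ?eqxx.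
Qed.

Lemma soft_eq0 x : mass (soft x) = 0 -> mass (soft (- x)) = 0 -> x = 0.
Proof.
move=> /mass_soft_eq0 x1 /mass_soft_eq0 x2; apply/eqP; apply: contraT => x0.
have t0 := threshold_gt0 x0.
have : \sum_i `|x 0 i| <= \sum_(i < n) threshold x.
  apply: ler_sum => i _; rewrite ler_norml x1 andbT lerNl.
  by have := x2 i; rewrite mxE thresholdN.
(* All [n] absolute values are at most the threshold, but their sum is [n + 1] times it. *)
have -> : \sum_i `|x 0 i| = threshold x * n.+1%:R by rewrite divfK ?pnatr_eq0.
rewrite sumr_const card_ord -[leRHS]mulr_natr ler_pM2l // ler_nat ltnn.
by [].
Qed.

Lemma disjoint_soft x : [disjoint vsupport (soft x) & vsupport (soft (- x))]%B.
Proof.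
rewrite -setI_eq0; apply/eqP/setP => i; rewrite !inE !soft_neq0 thresholdN mxE.
apply/negP => /andP[h1 h2]; have := threshold_ge0 x.
lra.
Qed.

Lemma threshold_continuous : continuous threshold.
Proof.
move=> x; apply: (@continuousM R 'rV[R]_n (fun z => \sum_i `|z 0 i|)
  (fun=> n.+1%:R^-1)); last exact: cst_continuous.
apply: continuous_at_sum => i.
apply: (@continuous_comp _ _ _ (fun y : 'rV[R]_n => y 0 i) Num.norm).
  exact: coord_continuous.
exact: norm_continuous.
Qed.

Lemma soft_continuous : continuous soft.
Proof.
move=> x; apply: continuous_at_row => i.
have -> : (fun z => soft z 0 i) = (fun z => Num.max 0 (z 0 i - threshold z)).
  by apply/funext => z; rewrite mxE.
apply: (@continuous_max R 'rV[R]_n (fun=> 0) (fun z => z 0 i - threshold z)).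
  exact: cst_continuous.
apply: continuousB; first exact: coord_continuous.
exact: threshold_continuous.
Qed.

Lemma mass_soft_continuous : continuous (fun x => mass (soft x)).
Proof.
move=> x; apply: continuous_at_sum => i.
by apply: continuous_at_coord; exact: soft_continuous.
Qed.

End SoftThreshold.

(** * Colour coordinates and the cutoff function *)

Section Obstruction.
Context (R : realType) (n : nat) (Sigma : simplicial_complex n).
Implicit Types (x : 'rV[R]_n) (s : {set 'I_n}).

(** Positive exactly when some entry of [x] in [s] is below the threshold; then [s] is not contained
    in the support of [soft x]. *)
Definition deficit s x : R := \sum_(i in s) Num.max 0 (threshold x - x 0 i).

(* Vanishes as soon as the support of [soft x] or [soft (- x)] is a nonface,
   hence makes the maps defined only on faces extend continuously by 0. *)
Definition cutoff x : R :=
  \prod_(s : {set 'I_n} | s \notin faces Sigma) (deficit s x * deficit s (- x)).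

Lemma cutoffN x : cutoff (- x) = cutoff x.
Proof. by apply: eq_bigr => s _; rewrite opprK mulrC. Qed.

Lemma vsupport_soft_face x : cutoff x != 0 -> vsupport (soft x) \in faces Sigma.
Proof.
move=> /prodf_neq0 c0; apply: contraT => /[dup] sS /c0; rewrite mulf_eq0 negb_or.
case/andP => + _; rewrite /deficit big1 ?eqxx // => i.
rewrite inE soft_neq0 => xi; apply/eqP; rewrite eq_le le_max lexx andbT.
by rewrite ge_max lexx subr_le0 ltW.
Qed.

Lemma deficit_neq0 s x i : x != 0 -> i \in s -> x 0 i <= 0 -> deficit s x != 0.
Proof.
move=> /threshold_gt0 x0 si xi; rewrite /deficit (bigD1 i) //= gt_eqF //.
rewrite ltr_pwDl ?sumr_ge0 // => [|j _]; last by rewrite le_max lexx.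
by rewrite lt_max; apply/orP; right; lra.
Qed.

Context (N : nat) (c : nonface Sigma -> 'I_N).
Hypothesis c_proper : forall s t : nonface Sigma, kneser_adj s t -> c s != c t.

(** The full positive part of [x] replaces [soft x] here: an entry found to be at most 0 is then
    strictly below the threshold, which makes [deficit] positive. *)
Definition colour_weight (j : nat) x : R :=
  \sum_(s : nonface Sigma | c s == j :> nat) \prod_(i in val s) Num.max 0 (x 0 i).

Lemma colour_weight_gt0 j x : 0 < colour_weight j x ->
  exists2 s : nonface Sigma, c s = j :> nat & forall i, i \in val s -> 0 < x 0 i.
Proof.
move=> w0; apply: contrapT => noS; move: w0; rewrite /colour_weight big1 ?ltxx //.
move=> s /eqP sj; apply/eqP; apply: contraT => /prodf_neq0 sx.
exfalso; apply: noS; exists s => // i /sx.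
by rewrite ltNge; apply: contra => xi; rewrite eq_le ge_max le_max !lexx xi.
Qed.

Lemma colour_weight_neq0 (s : nonface Sigma) x : (forall i, i \in val s -> 0 < x 0 i) ->
  0 < colour_weight (c s) x.
Proof.
move=> xs; rewrite /colour_weight (bigD1 s) //= ltr_pwDl //.
  by apply: prodr_gt0 => i /xs xi; rewrite lt_max xi orbT.
by apply: sumr_ge0 => t _; apply: prodr_ge0 => i _; rewrite le_max lexx.
Qed.

(** If a nonface [s] lay in the positive part of [x] or [- x], equal weights would give a nonface of
    the same colour in the opposite part, disjoint from [s], against properness. So both deficits of
    [s] are positive. *)
Lemma cutoff_neq0 x : x != 0 ->
  (forall j, (j < N)%N -> colour_weight j x = colour_weight j (- x)) ->
  cutoff x != 0.
Proof.
move=> x0 wE; apply/prodf_neq0 => s sS.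
have nofull z : z = x \/ z = - x -> exists2 i, i \in s & z 0 i <= 0.
  move=> zx; apply: contrapT => zs.
  pose S : nonface Sigma := exist _ s sS.
  have zS i : i \in val S -> 0 < z 0 i.
    by move=> si; rewrite ltNge; apply/negP => zi; apply: zs; exists i.
  have z1 := colour_weight_neq0 zS.
  have : 0 < colour_weight (c S) (- z).
    by case: zx z1 => ->; rewrite ?opprK wE.
  move=> /colour_weight_gt0[t tc tz].
  have : kneser_adj S t.
    rewrite /kneser_adj -setI_eq0; apply/eqP/setP => i; rewrite !inE.
    apply/negP => /andP[/zS zi /tz]; rewrite mxE; lra.
  by move=> /c_proper; rewrite -val_eqE /= tc eqxx.
have N0 : - x != 0 by rewrite oppr_eq0.
have [i si xi] := nofull x (or_introl erefl).
have [j sj xj] := nofull (- x) (or_intror erefl).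
by rewrite mulf_neq0 //; [exact: deficit_neq0 si xi | exact: deficit_neq0 sj xj].
Qed.

Lemma deficit_continuous s : continuous (deficit s).
Proof.
move=> x; apply: continuous_at_sum => i.
apply: (@continuous_max R 'rV[R]_n (fun=> 0) (fun z => threshold z - z 0 i)).
  exact: cst_continuous.
apply: continuousB; last exact: coord_continuous.
exact: threshold_continuous.
Qed.

Lemma cutoff_continuous : continuous cutoff.
Proof.
move=> x; apply: continuous_at_prod => s; apply: continuousM.
  exact: deficit_continuous.
apply: (@continuous_comp _ _ _ (fun z : 'rV[R]_n => - z) (deficit s)); first exact: opp_continuous.
exact: deficit_continuous.
Qed.

Lemma colour_weight_continuous j : continuous (colour_weight j).
Proof.
move=> x; apply: continuous_at_sum => s; apply: continuous_at_prod => i.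
apply: (@continuous_max R 'rV[R]_n (fun=> 0) (fun z => z 0 i)).
  exact: cst_continuous.
exact: coord_continuous.
Qed.

End Obstruction.

(** * Normalization to the sphere and to the realization *)

Section Normalization.
Context (R : realType) (k : nat) (y0 : sphere R k).
Implicit Types y : 'rV[R]_k.

Definition normalize y : 'rV[R]_k := (Num.sqrt (\sum_i y 0 i ^+ 2))^-1 *: y.

Lemma sum_sqr_gt0 y : y != 0 -> 0 < \sum_i y 0 i ^+ 2.
Proof.
move=> yn0; rewrite lt_neqAle sumr_ge0 ?andbT => [|i _]; last exact: sqr_ge0.
rewrite eq_sym; apply: contra yn0 => /eqP ys; apply/eqP/rowP => i; rewrite mxE.
apply/eqP; rewrite -sqrf_eq0; apply/eqP.
exact: (psumr_eq0P (fun j _ => sqr_ge0 (y 0 j)) ys).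
Qed.

Lemma normalize_sphere y : y != 0 -> sphere_set (normalize y).
Proof.
move=> /sum_sqr_gt0 y1; rewrite /sphere_set /=.
under eq_bigr do rewrite mxE exprMn.
by rewrite -mulr_sumr exprVn sqr_sqrtr ?ltW // mulVf // gt_eqF.
Qed.

(** [y0] is a default value, taken at [y = 0]. *)
Definition to_sphere y : sphere R k :=
  insubd (y0 : set_type (@sphere_set R k)) (normalize y).

Lemma to_sphereE y : y != 0 ->
  set_val (to_sphere y : set_type (@sphere_set R k)) = normalize y.
Proof. by move=> /normalize_sphere y1; rewrite set_valE /to_sphere val_insubd mem_set. Qed.

Lemma to_sphereN y : y != 0 -> to_sphere (- y) = Z2act (to_sphere y).
Proof.
move=> yn0; apply: val_inj; have E := to_sphereE.
rewrite /= -[LHS]/(set_val _) E ?oppr_eq0 // -[sval _]/(set_val (to_sphere y)) E //.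
by rewrite /normalize scalerN; under eq_bigr do rewrite mxE sqrrN.
Qed.

Lemma to_sphere_continuous y : y != 0 -> {for y, continuous to_sphere}.
Proof.
move=> yn0; apply: continuous_at_set_type.
have Fy := nbhs_filter y.
apply: (@continuous_at_near_eq _ _ _ normalize).
  have y1 : 0 < `|y| by rewrite normr_gt0.
  have /(_ Fy) := @cvgr_gt R _ _ _ _ _ (@norm_continuous _ _ y) _ y1.
  apply: (@filterS _ (nbhs y) Fy) => z /=.
  by rewrite normr_gt0 => /to_sphereE.
apply: (@cvgZ R 'rV[R]_k 'rV[R]_k (nbhs y) _
  (fun y : 'rV[R]_k => (Num.sqrt (\sum_i y 0 i ^+ 2))^-1) id); last exact: cvg_id.
apply: (@continuousV R 'rV[R]_k (fun y => Num.sqrt (\sum_i y 0 i ^+ 2))).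
  by rewrite sqrtr_eq0 -ltNge sum_sqr_gt0.
apply: (@continuous_comp _ _ _ (fun y : 'rV[R]_k => \sum_i y 0 i ^+ 2) Num.sqrt).
  by apply: continuous_at_sum => i; apply: continuousM; exact: coord_continuous.
exact: sqrt_continuous.
Qed.

End Normalization.

Section ToRealization.
Context (R : realType) (n : nat) (Sigma : simplicial_complex n).
Context (p0 : realization R Sigma).
Implicit Types x : 'rV[R]_n.

(** [p0] is a default value where the scaled vector is outside the realization; the weight
    [cutoff Sigma x * mass (soft x)] is 0 there. *)
Definition to_realization x : realization R Sigma :=
  insubd (p0 : set_type (@realization_set R n Sigma)) ((mass (soft x))^-1 *: soft x).

Lemma vsupport_scale (a : R) x : a != 0 -> vsupport (a *: x) = vsupport x.
Proof. by move=> a0; apply/setP => i; rewrite !inE mxE mulf_eq0 negb_or a0. Qed.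

Lemma realization_set_soft x : cutoff Sigma x * mass (soft x) != 0 ->
  realization_set Sigma ((mass (soft x))^-1 *: soft x).
Proof.
rewrite mulf_eq0 negb_or => /andP[cx mx]; split=> [i||].
- by rewrite mxE mulr_ge0 ?soft_ge0 // invr_ge0 mass_soft_ge0.
- by under eq_bigr do rewrite mxE; rewrite -mulr_sumr mulVf.
- by rewrite vsupport_scale ?invr_eq0 //; exact: vsupport_soft_face.
Qed.

Lemma to_realizationE x : cutoff Sigma x * mass (soft x) != 0 ->
  set_val (to_realization x : set_type (@realization_set R n Sigma)) =
  (mass (soft x))^-1 *: soft x.
Proof.
by move=> /realization_set_soft xS; rewrite set_valE /to_realization val_insubd mem_set.
Qed.

Lemma weight_continuous :
  continuous (fun x : 'rV[R]_n => cutoff Sigma x * mass (soft x)).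
Proof.
move=> x; apply: continuousM; first exact: cutoff_continuous.
exact: mass_soft_continuous.
Qed.

Lemma to_realization_continuous x : cutoff Sigma x * mass (soft x) != 0 ->
  {for x, continuous to_realization}.
Proof.
move=> cx; apply: continuous_at_set_type; have Fx := nbhs_filter x.
apply: (@continuous_at_near_eq _ _ _ (fun x => (mass (soft x))^-1 *: soft x)).
  have cx1 : 0 < `|cutoff Sigma x * mass (soft x)| by rewrite normr_gt0.
  have /(_ Fx) := @cvgr_gt R _ _ _ _ _ (@cvg_norm _ _ _ _ Fx _ _ (@weight_continuous x)) _ cx1.
  apply: (@filterS _ (nbhs x) Fx) => z /=.
  by rewrite normr_gt0 => /to_realizationE.
apply: (@cvgZ R 'rV[R]_n 'rV[R]_n (nbhs x) _
  (fun x => (mass (soft x))^-1) (@soft R n)); last exact: soft_continuous.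
apply: (@continuousV R 'rV[R]_n (fun x => mass (soft x))).
  by move: cx; rewrite mulf_eq0 negb_or => /andP[].
exact: mass_soft_continuous.
Qed.

End ToRealization.

Section Coordinates.
Context (R : realType) (d l : nat).
Implicit Types w : 'rV[R]_d.

(* Extends the coordinates by 0 to all natural indices. *)
Definition coord_nat (i : nat) w : R := \sum_(j < d | j == i :> nat) w 0 j.

Lemma coord_natE w (i : 'I_d) : coord_nat i w = w 0 i.
Proof. by rewrite /coord_nat (big_pred1 i). Qed.

Lemma coord_nat_reflect i w :
  coord_nat i (reflect_coords l w) = (-1) ^+ (i < l)%N * coord_nat i w.
Proof.
rewrite /coord_nat mulr_sumr; apply: eq_bigr => j /eqP<-; rewrite mxE.
by case: ifP; rewrite ?mulN1r ?mul1r.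
Qed.

Lemma coord_nat_continuous i : continuous (coord_nat i).
Proof. by move=> w; apply: continuous_at_sum => j; exact: coord_continuous. Qed.

End Coordinates.

(** * Assembly and nonvanishing of the test map *)

Section TestMap.
Context (R : realType) (n : nat) (Sigma : simplicial_complex n.+1) (d l k : nat).
Hypothesis hld : (l <= d)%N.
Context (N : nat) (c : nonface Sigma -> 'I_N).
Hypothesis c_proper : forall s t : nonface Sigma, kneser_adj s t -> c s != c t.
Context (f : sphere R k -> map_space R Sigma d).
Hypothesis f_cont : continuous f.
Hypothesis f_equiv : forall y, f (Z2act y) = reflect_map l (f y).
Hypothesis f_AEmb : forall y, AEmb_set (f y).
Context (y0 : sphere R k) (p0 : realization R Sigma).
Local Notation V := ('rV[R]_k * 'rV[R]_n.+1)%type.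

(** The exponential law: the realization is compact Hausdorff, so a continuous map into the
    compact-open function space is jointly continuous. *)
Let f_joint : continuous (uncurry f).
Proof.
apply: continuous_uncurry => //.
- exact/compact_locally_compact/compact_realization.
- exact: hausdorff_realization.
- by move=> y; have [] := f_AEmb y.
Qed.

(** Provides the bound for the extension by 0 in [half_map_continuous]; the sphere and the
    realization are compact. *)
Let f_bounded i : exists M : R, forall y p, `|coord_nat i (f y p)| <= M.
Proof.
pose h := coord_nat i \o uncurry f.
have ch : continuous h.
  move=> v; apply: continuous_comp; first exact: f_joint.
  exact: coord_nat_continuous.
have : compact (h @` (setT `*` setT)).
  apply: continuous_compact; first exact: continuous_subspaceT.
  by apply: compact_setX; [exact: compact_sphere | exact: compact_realization].
move=> /compact_bounded [M [_ MP]]; exists (`|M| + 1) => y p.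
apply: MP; first by rewrite (le_lt_trans (ler_norm _)) // ltrDl.
by exists (y, p).
Qed.

(** The vector [|u| f(y)(u/|u|)], multiplied by the even factor [cutoff] so that it extends by 0. *)
Definition half_map i (v : V) : R :=
  (cutoff Sigma v.2 * mass (soft v.2)) *
  coord_nat i (f (to_sphere y0 v.1) (to_realization p0 v.2)).

(** The coordinates of [f] come first, so that the reflected ones are the first [l] of all, as
    [even_bin_of_nonvanishing] requires. *)
Definition test_map i (v : V) : R :=
  if (i < d)%N then half_map i v - half_map i (v.1, - v.2)
  else if i == d then mass (soft v.2) - mass (soft (- v.2))
  else colour_weight c (i - d.+1) v.2 - colour_weight c (i - d.+1) (- v.2).

Lemma half_map_continuous i v : v.1 != 0 -> {for v, continuous (half_map i)}.
Proof.
case: v => y x /= yn0; have [M fM] := f_bounded i.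
apply: (@continuous_at_mul_bounded R V
  (fun v => cutoff Sigma v.2 * mass (soft v.2))
  (fun v => coord_nat i (f (to_sphere y0 v.1) (to_realization p0 v.2))) M) => //.
  apply: (@continuous_comp V _ _ snd (fun x => cutoff Sigma x * mass (soft x))).
    exact: cvg_snd.
  exact: weight_continuous.
move=> /= cx.
apply: (@continuous_comp V _ _
  (fun v => (to_sphere y0 v.1, to_realization p0 v.2)) (coord_nat i \o uncurry f)).
  apply: continuous_at_pair.
    apply: (@continuous_comp V _ _ fst (to_sphere y0)); first exact: cvg_fst.
    exact: to_sphere_continuous.
  apply: (@continuous_comp V _ _ snd (to_realization p0)); first exact: cvg_snd.
  exact: to_realization_continuous.
apply: continuous_comp; first exact: f_joint.
exact: coord_nat_continuous.
Qed.

Let oppr_continuous : continuous (fun v : V => (v.1, - v.2)).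
Proof.
move=> v; apply: continuous_at_pair; first exact: cvg_fst.
by apply: (@continuous_comp V _ _ snd (fun x => - x)); [exact: cvg_snd|exact: opp_continuous].
Qed.

Let odd_snd_continuous (h : 'rV[R]_n.+1 -> R) : continuous h ->
  continuous (fun v : V => h v.2 - h (- v.2)).
Proof.
move=> ch v; apply: continuousB.
  by apply: (@continuous_comp V _ _ snd h); [exact: cvg_snd|exact: ch].
apply: (@continuous_comp V _ _ (fun v => - v.2) h); last exact: ch.
by apply: (@continuous_comp V _ _ snd (fun x => - x)); [exact: cvg_snd|exact: opp_continuous].
Qed.

Lemma test_map_continuous i v : v.1 != 0 -> {for v, continuous (test_map i)}.
Proof.
move=> v0; rewrite /test_map; case: (i < d)%N.
  apply: (@continuousB _ _ _ (half_map i) (half_map i \o (fun v => (v.1, - v.2)))).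
    exact: half_map_continuous.
  apply: continuous_comp; first exact: oppr_continuous.
  exact: half_map_continuous.
case: (i == d).
  exact: (odd_snd_continuous (@mass_soft_continuous R n.+1)).
exact: (odd_snd_continuous (@colour_weight_continuous R _ Sigma N c (i - d.+1))).
Qed.

Lemma test_map_negl i y x : y != 0 ->
  test_map i (- y, x) = (-1) ^+ (i < l)%N * test_map i (y, x).
Proof.
move=> yn0; rewrite /test_map /half_map /= to_sphereN // f_equiv /reflect_map /=.
rewrite !coord_nat_reflect; case: ifP => [_|/negbT]; first by rewrite mulrBr; congr (_ - _); ring.
by rewrite -leqNgt => di; rewrite ltnNge (leq_trans hld di) /= expr0 !mul1r.
Qed.

Lemma test_map_negr i y x : test_map i (y, - x) = - test_map i (y, x).
Proof. by rewrite /test_map /= opprK; case: ifP => _; [|case: ifP => _]; rewrite opprB. Qed.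

Lemma test_map_neq0 y x : y != 0 -> x != 0 ->
  exists2 i, (i < d.+1 + N)%N & test_map i (y, x) != 0.
Proof.
move=> yn0 xn0; apply: contrapT => noi.
have t0 i : (i < d.+1 + N)%N -> test_map i (y, x) = 0.
  move=> iN; apply/eqP; apply: contraT => ti0.
  by exfalso; apply: noi; exists i.
(* The colour coordinates ensure that both supports are faces. *)
have cx : cutoff Sigma x != 0.
  apply: (cutoff_neq0 c_proper xn0) => j jN; apply/eqP; rewrite -subr_eq0.
  have := t0 (d.+1 + j)%N; rewrite ltn_add2l => /(_ jN).
  rewrite /test_map ltnNge addSn ltnW ?ltnS ?leq_addr //= gtn_eqF ?ltnS ?leq_addr //.
  by rewrite subSS addKn => ->.
have cNx : cutoff Sigma (- x) != 0 by rewrite cutoffN.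
(* Coordinate [d] makes the masses equal; they are nonzero since [x] is. *)
have mE : mass (soft x) = mass (soft (- x)).
  apply/eqP; rewrite -subr_eq0; have := t0 d; rewrite addSn ltnS leq_addr => /(_ isT).
  by rewrite /test_map ltnn eqxx => ->.
have m0 : mass (soft x) != 0.
  by apply: contra xn0 => /eqP m0; apply/eqP/soft_eq0 => //; rewrite -mE.
have mN0 : mass (soft (- x)) != 0 by rewrite -mE.
pose ys := to_sphere y0 y; pose p := to_realization p0 x.
pose q := to_realization p0 (- x).
(* Cancelling the common factor in the first [d] coordinates leaves two points of disjoint faces
   with the same image. *)
have fpq : f ys p = f ys q.
  apply/rowP => i; rewrite -!coord_natE.
  have := t0 i; rewrite addSn ltnS (leq_trans (ltnW (ltn_ord i))) ?leq_addr // => /(_ isT).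
  rewrite /test_map ltn_ord /half_map /= cutoffN -mE -mulrBr.
  by move=> /eqP; rewrite mulf_eq0 (negbTE (mulf_neq0 cx m0)) /= subr_eq0 => /eqP.
have [_ /(_ (vsupport (soft x)) (vsupport (soft (- x))))] := f_AEmb ys.
have in_face z : cutoff Sigma z != 0 -> mass (soft z) != 0 ->
    closed_face (vsupport (soft z)) (to_realization p0 z).
  move=> cz mz; rewrite /closed_face /= -[val _]/(set_val (to_realization p0 z)).
  by rewrite to_realizationE ?mulf_neq0 // vsupport_scale ?invr_eq0.
move=> /(_ (vsupport_soft_face cx) (vsupport_soft_face cNx) (disjoint_soft x)).
rewrite -subset0 => /(_ (f ys p)); apply; split.
  by exists p => //; exact: in_face.
by rewrite fpq; exists q => //; exact: in_face.
Qed.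

End TestMap.

(** * From the test map to the coindex bounds *)

Lemma chromatic_coloring (G : sgraph) :
  exists c : G -> 'I_(chromatic_number G), forall x y, adj x y -> c x != c y.
Proof.
rewrite /chromatic_number; case: ex_minnP => N /existsP[c /forallP cP] _.
by exists c => x y xy; have /forallP/(_ y)/implyP := cP x; apply.
Qed.

(** If no singleton is a face, the singletons are [n] pairwise adjacent vertices of the Kneser graph
    and need [n] colours. *)
Lemma realization_inhabited (R : realType) n (Sigma : simplicial_complex n) :
  (chromatic_number (KG Sigma) < n)%N -> inhabited (realization R Sigma).
Proof.
have [c cP] := chromatic_coloring (KG Sigma) => chin.
have [i iS] : exists i : 'I_n, [set i]%SET \in faces Sigma.
  apply: contrapT => noi.
  have iS i : [set i]%SET \notin faces Sigma by apply/negP => iS; apply: noi; exists i.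
  pose s i : nonface Sigma := exist _ [set i]%SET (iS i).
  suff /leq_card : injective (fun i => c (s i)) by rewrite !card_ord leqNgt chin.
  move=> i j /eqP cij; apply/eqP; move: cij; apply: contraTT => ij.
  by apply: cP; rewrite /= /kneser_adj /= disjoints1 inE.
have xS : realization_set Sigma (delta_mx 0 i : 'rV[R]_n).
  split=> [j||]; first by rewrite mxE ler0n.
    rewrite (bigD1 i) //= mxE !eqxx big1 ?addr0 // => j ji.
    by rewrite mxE (negbTE ji) andbF.
  rewrite (_ : vsupport _ = [set i]%SET) //; apply/setP => j; rewrite !inE mxE /=.
  by rewrite pnatr_eq0 eqb0 negbK.
by constructor; exists (delta_mx 0 i : 'rV[R]_n); exact: mem_set xS.
Qed.

Lemma no_equivariant_map_AEmb (R : realType) (n : nat) (Sigma : simplicial_complex n)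
    (d l m k : nat) (f : sphere R k -> map_space R Sigma d) :
  (l <= d)%N ->
  m%:Z = d%:Z - n%:Z + (chromatic_number (KG Sigma))%:Z + 2 ->
  (m <= l)%N -> ~ share_common_one m (l - m)%N -> (m < k)%N ->
  continuous f -> (forall y, f (Z2act y) = reflect_map l (f y)) ->
  (forall y, AEmb_set (f y)) -> False.
Proof.
move=> hld hm hml hbin mk f_cont f_equiv f_AEmb.
(* From [m <= l <= d] the formula for [m] bounds the chromatic number by [n - 2]. *)
have chin : (chromatic_number (KG Sigma) < n)%N by lia.
have [p0] := realization_inhabited R chin.
have [c cP] := chromatic_coloring (KG Sigma).
(* Both [n] and [k] are positive; from here on they denote the predecessors of the original
   values. *)
case: n Sigma f hm f_cont f_equiv f_AEmb chin p0 c cP =>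
  // n Sigma f hm f_cont f_equiv f_AEmb chin p0 c cP.
case: k mk f f_cont f_equiv f_AEmb => // k mk f f_cont f_equiv f_AEmb.
have y1 : sphere_set (normalize (const_mx 1 : 'rV[R]_k.+1)).
  apply: normalize_sphere; apply/eqP => /rowP/(_ 0); rewrite !mxE => /eqP.
  by rewrite oner_eq0.
pose y0 : sphere R k.+1 := exist (fun y => y \in @sphere_set R k.+1) _ (mem_set y1).
(* The test map has as many coordinates as the dimension of [c_(m,n)]. *)
have mn : (m + n = d.+1 + chromatic_number (KG Sigma))%N by lia.
have lmn : (l <= m + n)%N by rewrite mn; lia.
suff : odd 'C(l, m) = false by rewrite -(subnKC hml) odd_bin_no_common_one.
apply: (@even_bin_of_nonvanishing R k.+1 n m l mk lmn (test_map c f y0 p0)).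
- by move=> i y x yn0 _; exact: test_map_negl.
- by move=> i y x _ _; exact: test_map_negr.
- by move=> i y x yn0 _; exact: test_map_continuous.
- by move=> y x yn0 xn0; rewrite mn; exact: test_map_neq0.
Qed.

(** By injectivity a common image point comes from one point supported in both disjoint faces; its
    coordinates are all 0, yet sum to 1. *)
Lemma Emb_sub_AEmb (R : realType) n (Sigma : simplicial_complex n) d :
  @Emb_set R n Sigma d `<=` @AEmb_set R n Sigma d.
Proof.
move=> f [cf fI _]; split=> // s t _ _ st; rewrite -subset0 => _ [[x xs <-] [y yt]].
move=> /fI yx; subst y; have [_ x1 _] := set_valP x.
have x0 i : val x 0 i = 0.
  apply/eqP; apply: contraT => xi.
  have is_ : i \in s by apply: (fintype.subsetP xs); rewrite inE.
  have it : i \in t by apply: (fintype.subsetP yt); rewrite inE.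
  by have /disjointFr/(_ is_) := st; rewrite it.
move: x1; rewrite big1 => [/esym/eqP|i _]; last exact: x0.
by rewrite oner_eq0.
Qed.

(** Composing with the inclusion treats both spaces at once; since [sphere R k] is the sphere of
    dimension [k - 1], the maps to exclude are those with [m < k]. *)
Lemma coindex_Z2sub_le (R : realType) n (Sigma : simplicial_complex n) d l m
    (A : set (map_space R Sigma d))
    (A_stable : forall g, A g -> A (reflect_map l g)) :
  (forall k (f : sphere R k -> map_space R Sigma d), (m < k)%N -> continuous f ->
    (forall y, f (Z2act y) = reflect_map l (f y)) -> ~ (forall y, A (f y))) ->
  (coindex R (Z2sub (@reflect_map_continuous R n Sigma d l)
    (@reflect_mapK R n Sigma d l) A_stable) <= (m%:R - 1)%:E)%E.
Proof.
move=> no_f; apply: ge_ereal_sup => _ [k [f [cf ef]] <-].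
rewrite lee_fin lerD2r ler_nat leqNgt; apply/negP => mk.
apply: (no_f k (fun y => set_val (f y)) mk) => [y|y|y].
- apply: (@continuous_comp _ _ _ f set_val); first exact: cf.
  exact: set_val_continuous.
- by rewrite ef.
- exact: set_valP.
Qed.

Theorem theorem1p5 (R : realType) (n : nat) (Sigma : simplicial_complex n)
    (d l : nat) (hld : (l <= d)%N) (m : nat)
    (hm : m%:Z = d%:Z - n%:Z + (chromatic_number (KG Sigma))%:Z + 2)
    (hml : (m <= l)%N)
    (hbin : ~ share_common_one m (l - m)%N) :
  (coindex R (AEmb R Sigma d l) <= (m%:R - 1)%:E)%E /\
  (coindex R (Emb R Sigma d l) <= (m%:R - 1)%:E)%E.
Proof.
split; apply: coindex_Z2sub_le => k f mk cf ef fA.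
  exact: (no_equivariant_map_AEmb hld hm hml hbin mk cf ef).
by apply: (no_equivariant_map_AEmb hld hm hml hbin mk cf ef) => y; exact: Emb_sub_AEmb.
Qed.
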